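(* Let $n\ge1$. For $w\in B_n$, the following statements are equivalent: (i) $w$ is $L_{B_n}$-principal. (ii) $L_{B_n}(w)$ is an rbg tuple. (iii) $w$ avoids the eight signed patterns $$\overline{2}1,\quad 1\overline{2},\quad \overline{3}\,\overline{2}\,\overline{1},\quad \overline{2}\,\overline{3}\,\overline{1},\quad \overline{2}\,\overline{1}\,\overline{3},\quad 3\overline{2}\,\overline{1},\quad 3\overline{1}2,\quad 312.$$ In particular, $|\mathrm{Pr}(L_{B_n})|=C_n+C_{n+1}-1$, where $\mathrm{Pr}(L_{B_n})$ is the set of $L_{B_n}$-principal elements and $C_n=\frac{1}{n+1}\binom{2n}{n}$ is the $n$th Catalan number.
   Context: $B_n$ is the group of signed permutations $w=w_1\cdots w_n$ (each $w_i\in\{\pm1,\ldots,\pm n\}$ and $\{|w_1|,\ldots,|w_n|\}=\{1,\ldots,n\}$), with simple reflections $s_0,\ldots,s_{n-1}$; right multiplication by $s_i$ ($1\le i\le n-1$) interchanges the entries in positions $i$ and $i+1$, and right multiplication by $s_0$ changes the sign of the first entry. A bar denotes negation: $\overline a=-a$. $B_n$ carries the Bruhat order $\le$ with respect to these generators, with length function $\ell$. Canonical Lehmer code $L_{B_n}$: let $W_k$ ($0\le k\le n$) be the standard parabolic subgroup generated by $s_0,\ldots,s_{k-1}$. Every $w\in B_n$ factors uniquely as $w=w^{(1)}w^{(2)}\cdots w^{(n)}$ where $w^{(k)}$ is a minimal-length representative of a right coset in $W_{k-1}\backslash W_k$ (the elements $w^{(k)}$ that can occur are those given by the prefixes, including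 the empty one, of the reduced expression $s_{k-1}s_{k-2}\cdots s_1s_0s_1\cdots s_{k-1}$). Then $L_{B_n}(w)=(\ell(w^{(1)}),\ldots,\ell(w^{(n)}))$; this is a bijection from $B_n$ onto $\prod_{i=1}^n\{0,1,\ldots,2i-1\}$. An element $w\in B_n$ is $L_{B_n}$-principal if for every $u\in B_n$, $u\le w$ implies $L_{B_n}(u)\preceq L_{B_n}(w)$, where $\preceq$ is the componentwise order. An rbg (reflected bounded-growth) tuple is a tuple $(a_1,\ldots,a_n)\in\mathbb Z^n$ such that $0\le a_i\le 2i-1$ for $1\le i\le n$ and, for every $2\le i\le n$, if $a_{i-1}<2i-3$ then $a_i\le\min\{a_{i-1}+1,\,2i-3-a_{i-1}\}$. Signed pattern avoidance: $w\in B_n$ contains the pattern $v=v_1\cdots v_k\in B_k$ if there are indices $1\le i_1<\cdots<i_k\le n$ such that $w_{i_j}$ and $v_j$ have the same sign for each $j$, and $|w_{i_1}|,\ldots,|w_{i_k}|$ are in the same relative order as $|v_1|,\ldots,|v_k|$; otherwise $w$ avoids $v$. *)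

(* Defs.v *)
From HB Require Import structures.
From mathcomp Require Import all_boot all_order all_algebra all_fingroup.

Set Implicit Arguments.
Unset Strict Implicit.
Unset Printing Implicit Defensive.

Import Order.TTheory GRing.Theory Num.Theory.

Local Open Scope group_scope.

(* Positions and absolute values are indexed from 0: position i : 'I_n is the
   (i+1)-st position, and the letter there is  w_(i+1) = +/- (sp_abs w i + 1),
   with a minus sign exactly when sp_neg w i. *)
Record signed_perm (n : nat) : Type :=
  SignedPerm { sp_abs : 'S_n; sp_neg : {ffun 'I_n -> bool} }.

Definition sp_pair n (w : signed_perm n) : 'S_n * {ffun 'I_n -> bool} :=
  (sp_abs w, sp_neg w).
Definition pair_sp n (p : 'S_n * {ffun 'I_n -> bool}) : signed_perm n :=
  SignedPerm p.1 p.2.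

Lemma sp_pairK n : cancel (@sp_pair n) (@pair_sp n).
Proof. by case. Qed.

HB.instance Definition _ n := Finite.copy (signed_perm n) (can_type (@sp_pairK n)).

Lemma signed_permP n (u v : signed_perm n) :
  sp_abs u = sp_abs v -> sp_neg u =1 sp_neg v -> u = v.
Proof. by case: u v => [s e] [t f] /= -> /ffunP ->. Qed.

Definition entry n (w : signed_perm n) (i : 'I_n) : int :=
  ((-1) ^+ sp_neg w i * (sp_abs w i).+1%:Z)%R.

Definition window n (w : signed_perm n) : seq int := [seq entry w i | i <- enum 'I_n].

(* The product is composition of maps on {+/-1, ..., +/-n}, (u v)(x) = u(v(x)),
   so that right multiplication acts on positions.  In 'S_n the library composes
   in the opposite order, (s * t) x = t (s x). *)
Definition sp_one n : signed_perm n := SignedPerm 1 [ffun=> false].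

Definition sp_mul n (u v : signed_perm n) : signed_perm n :=
  SignedPerm (sp_abs v * sp_abs u)
             [ffun i => sp_neg v i (+) sp_neg u (sp_abs v i)].

Definition sp_inv n (u : signed_perm n) : signed_perm n :=
  SignedPerm (sp_abs u)^-1 [ffun i => sp_neg u ((sp_abs u)^-1 i)].

Lemma sp_mulA n : associative (@sp_mul n).
Proof.
move=> u v w; apply: signed_permP => [|i] /=; first by rewrite mulgA.
by rewrite !ffunE permM addbA.
Qed.

Lemma sp_mul1 n : left_id (@sp_one n) (@sp_mul n).
Proof.
by move=> u; apply: signed_permP => [|i] /=; rewrite ?mulg1 // !ffunE addbF.
Qed.

Lemma sp_mulV n : left_inverse (@sp_one n) (@sp_inv n) (@sp_mul n).
Proof.
move=> u; apply: signed_permP => [|i] /=; first by rewrite mulgV.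
by rewrite !ffunE permK addbb.
Qed.

HB.instance Definition _ n :=
  Finite_isGroup.Build (signed_perm n) (@sp_mulA n) (@sp_mul1 n) (@sp_mulV n).

(* For i > 0 the value of  ord_pred i  is i - 1; positions i - 1 and i counted
   from 0 are positions i and i + 1 counted from 1. *)
Definition simple n (i : 'I_n) : signed_perm n :=
  if i == 0%N :> nat then SignedPerm 1 [ffun j => j == i]
  else SignedPerm (tperm (ord_pred i) i) [ffun=> false].

Definition simples n : {set signed_perm n} := [set simple i | i : 'I_n].

Definition inj_perm n (s : 'S_n) : signed_perm n := SignedPerm s [ffun=> false].
Definition flips n (e : {ffun 'I_n -> bool}) : signed_perm n := SignedPerm 1 e.

Lemma mul_inj_perm n (s t : 'S_n) : inj_perm s * inj_perm t = inj_perm (t * s).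
Proof. by apply: signed_permP => // i; rewrite /= !ffunE. Qed.

Lemma mul_flips n (e f : {ffun 'I_n -> bool}) :
  flips e * flips f = flips [ffun i => e i (+) f i].
Proof.
apply: signed_permP => [|i] /=; first by rewrite mulg1.
by rewrite !ffunE perm1 addbC.
Qed.

Lemma sp_decomp n (w : signed_perm n) :
  w = inj_perm (sp_abs w) * flips (sp_neg w).
Proof.
apply: signed_permP => [|i] /=; first by rewrite mul1g.
by rewrite !ffunE addbF.
Qed.

Lemma tperm_simples n (i j : 'I_n) :
  (i < j)%N -> inj_perm (tperm i j) \in <<simples n>>.
Proof.
have [m] := ubnP (j : nat); elim: m => // m IH in j * => /ltnSE lejm ltij.
have j0 : (j == 0%N :> nat) = false by rewrite eqn0Ngt (leq_ltn_trans _ ltij).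
have jE : ord_pred j = j.-1 :> nat.
  have jgt0 : (0 < j)%N by rewrite lt0n j0.
  rewrite /= -(prednK jgt0) /= modnDr modn_small //.
  by rewrite (leq_ltn_trans (leq_pred _)).
have Sj : inj_perm (tperm (ord_pred j) j) \in <<simples n>>.
  rewrite mem_gen //; apply/imsetP; exists j => //.
  by rewrite /simple j0.
have [eqi | nei] := eqVneq i (ord_pred j); first by rewrite eqi.
have ltip : (i < ord_pred j)%N.
  have neij : (i != j.-1 :> nat) by rewrite -jE.
  by rewrite ltn_neqAle jE neij -ltnS prednK // lt0n j0.
have ltpm : (ord_pred j < m)%N.
  by rewrite jE; case: (j : nat) j0 lejm.
have := IH _ ltpm ltip => Gp.
have -> : tperm i j =
    tperm (ord_pred j) j * (tperm i (ord_pred j) * tperm (ord_pred j) j).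
  have <- : tperm i (ord_pred j) ^ tperm (ord_pred j) j = tperm i j.
    rewrite tpermJ tpermL tpermD //; first by rewrite eq_sym.
    by rewrite -val_eqE neq_ltn ltij orbT.
  by rewrite conjgE tpermV.
by rewrite -!mul_inj_perm !groupM.
Qed.

Lemma inj_perm_simples n (s : 'S_n) : inj_perm s \in <<simples n>>.
Proof.
have [ts -> _] := prod_tpermP s.
elim: ts => [|[i j] ts IH]; first by rewrite big_nil (group1 <<simples n>>).
rewrite big_cons -mul_inj_perm groupM //=.
have [ltij | ltji | /val_inj ->] := ltngtP i j.
- exact: tperm_simples.
- by rewrite tpermC tperm_simples.
- by rewrite tperm1 (group1 <<simples n>>).
Qed.

Lemma flip1_simples n (i : 'I_n) :
  flips [ffun j => j == i] \in <<simples n>>.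
Proof.
case: n i => [[]//|n] i.
have S0 : flips [ffun j => j == ord0 :> 'I_n.+1] \in <<simples n.+1>>.
  by rewrite mem_gen //; apply/imsetP; exists ord0.
have -> : flips [ffun j => j == i] =
    inj_perm (tperm ord0 i) * flips [ffun j => j == ord0] * inj_perm (tperm ord0 i).
  apply: signed_permP => [|j] /=; first by rewrite mul1g tperm2.
  rewrite !ffunE addbF; apply/eqP/eqP => [->|]; first by rewrite tpermR.
  by move/(canRL (tpermK _ _)) => ->; rewrite tpermL.
by rewrite !groupM ?inj_perm_simples.
Qed.

Lemma flips_simples n (e : {ffun 'I_n -> bool}) : flips e \in <<simples n>>.
Proof.
have -> : flips e = \prod_(i | e i) flips [ffun j => j == i].
  have H (r : seq 'I_n) : \prod_(i <- r | e i) flips [ffun j => j == i] =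
     flips [ffun j => odd (count_mem j [seq i <- r | e i])].
    elim: r => [|k r IH].
      by rewrite big_nil; apply: signed_permP => // i; rewrite !ffunE.
    rewrite big_cons /=; case: ifP => // ek; rewrite IH mul_flips.
    by congr flips; apply/ffunP=> j; rewrite !ffunE /= oddD oddb eq_sym.
  rewrite H; congr flips; apply/ffunP => j; rewrite !ffunE.
  rewrite count_uniq_mem ?filter_uniq ?index_enum_uniq //.
  by rewrite mem_filter mem_index_enum andbT oddb.
by apply: group_prod => i _; apply: flip1_simples.
Qed.

Lemma gen_simples n : <<simples n>> = [set: signed_perm n].
Proof.
apply/eqP; rewrite eqEsubset subsetT; apply/subsetP => w _.
by rewrite (sp_decomp w) groupM ?inj_perm_simples ?flips_simples.
Qed.

Definition has_word n (w : signed_perm n) (m : nat) : bool :=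
  [exists t : m.-tuple 'I_n, w == \prod_(i <- t) simple i].

Lemma exists_word n (w : signed_perm n) : exists m, has_word w m.
Proof.
have: w \in <<simples n>> by rewrite gen_simples inE.
move=> /gen_prodgP [m [c Sc ->]].
have Pc i : exists j : 'I_n, c i == simple j.
  by have /imsetP[j _ ->] := Sc i; exists j.
exists m; apply/existsP; exists [tuple xchoose (Pc i) | i < m].
rewrite big_tuple; apply/eqP/eq_bigr => i _; rewrite tnth_mktuple.
exact/eqP/(xchooseP (Pc i)).
Qed.

Definition length n (w : signed_perm n) : nat := ex_minn (exists_word w).

Definition reflections n : {set signed_perm n} :=
  class_support (simples n) [set: signed_perm n].

Definition bruhat_step n : rel (signed_perm n) := fun u v =>
  (length u < length v)%N && [exists t in reflections n, v == u * t].

Definition bruhat n : rel (signed_perm n) := connect (@bruhat_step n).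

Definition parabolic n (k : nat) : {group signed_perm n} :=
  <<[set simple i | i : 'I_n & (i < k)%N]>>%G.

Definition min_coset_rep n (k : nat) (x : signed_perm n) : bool :=
  (x \in parabolic n k.+1) &&
  [forall y in parabolic n k :* x, (length x <= length y)%N].

(* The factor f k, for k : 'I_n counted from 0, is w^(k+1), a representative of a
   right coset in W_k \ W_(k+1).  The product is taken in increasing order. *)
Definition is_factorization n (w : signed_perm n)
    (f : {ffun 'I_n -> signed_perm n}) : bool :=
  [forall k : 'I_n, min_coset_rep k (f k)] && (w == \prod_(k < n) f k).

Lemma exists_factorization n (w : signed_perm n) :
  exists f, is_factorization w f.
Proof.
suff H m : forall x, x \in parabolic n m ->
    exists g : nat -> signed_perm n, (forall k, (k < m)%N -> min_coset_rep k (g k)) /\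
      x = \prod_(0 <= k < m) g k.
  have [|g [Hg ->]] := H n w.
    suff -> : parabolic n n = <<simples n>>%G by rewrite /= gen_simples inE.
    apply/val_inj; congr <<_>>; apply/setP => x; apply/imsetP/imsetP.
      by case=> i _ ->; exists i.
    by case=> i _ ->; exists i; rewrite ?inE ?ltn_ord.
  exists [ffun k : 'I_n => g k]; apply/andP; split.
    by apply/forallP=> k; rewrite ffunE Hg.
  by rewrite big_mkord; apply/eqP/eq_bigr => k _; rewrite ffunE.
elim: m => [|m IH] x xW.
  exists (fun=> 1); split => //; rewrite big_nil.
  move: xW; rewrite /parabolic /=.
  suff -> : [set simple i | i : 'I_n & (i < 0)%N] = set0 :> {set signed_perm n}.
    by rewrite gen0 => /set1P.
  by apply/setP => y; rewrite inE; apply/imsetP => -[i]; rewrite inE.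
case: (arg_minnP (@length n) (rcoset_refl (parabolic n m) x)) => y yx miny.
have sub : parabolic n m \subset parabolic n m.+1.
  apply: genS; apply/subsetP => _ /imsetP[i Hi ->]; apply/imset_f.
  by move: Hi; rewrite !inE => /ltnW.
have [u uW yE] := rcosetP yx.
have [g [Hg ux]] := IH _ (groupVr uW).
exists (fun k => if (k < m)%N then g k else y); split.
  move=> k; rewrite ltnS leq_eqVlt; case: ltnP => [ltkm _|lemk]; first exact: Hg.
  rewrite orbF => /eqP ->; apply/andP; split.
    by rewrite yE groupM // (subsetP sub).
  by apply/forall_inP => z; rewrite (rcoset_eqP yx); apply: miny.
rewrite big_nat_recr //= ltnn big_nat.
under eq_bigr => k /andP[_ ->] do [].
by rewrite -big_nat -ux yE mulKg.
Qed.

(* Factorizations are in fact unique; only existence is needed to choose one. *)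
Definition factors n (w : signed_perm n) : {ffun 'I_n -> signed_perm n} :=
  xchoose (exists_factorization w).

Definition lehmer n (w : signed_perm n) : {ffun 'I_n -> nat} :=
  [ffun k => length (factors w k)].

Definition principal n (w : signed_perm n) : bool :=
  [forall u : signed_perm n,
     bruhat u w ==> [forall i, (lehmer u i <= lehmer w i)%N]].

Local Open Scope ring_scope.

(* The term a_(i+1) of the tuple is [a i], so [i.+1] plays the role of the
   1-based index. *)
Definition rbg n (a : {ffun 'I_n -> int}) : Prop :=
  (forall i : 'I_n, 0 <= a i <= 2 * i.+1%:Z - 1) /\
  (forall h i : 'I_n, i = h.+1 :> nat ->
     a h < 2 * i.+1%:Z - 3 ->
     a i <= Order.min (a h + 1) (2 * i.+1%:Z - 3 - a h)).

Definition contains (w v : seq int) : Prop :=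
  exists f : 'I_(size v) -> 'I_(size w),
    [/\ forall j k : 'I_(size v), (j < k)%N -> (f j < f k)%N,
        forall j : 'I_(size v), Num.sg w`_(f j) = Num.sg v`_j
      & forall j k : 'I_(size v),
          (`|w`_(f j)| < `|w`_(f k)|) = (`|v`_j| < `|v`_k|) ].

Definition avoids (w v : seq int) : Prop := ~ contains w v.

Definition lehmer_patterns : seq (seq int) :=
  [:: [:: -2; 1]; [:: 1; -2]; [:: -3; -2; -1]; [:: -2; -3; -1];
      [:: -2; -1; -3]; [:: 3; -2; -1]; [:: 3; -1; 2]; [:: 3; 1; 2]].

Definition catalan (n : nat) : rat := n.+1%:R^-1 * 'C(2 * n, n)%:R.

(* Main.v *)
Require Import Defs.
From HB Require Import structures.
From mathcomp Require Import all_boot all_order all_algebra all_fingroup.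
From mathcomp Require Import zify.
Set Implicit Arguments.
Unset Strict Implicit.
Unset Printing Implicit Defensive.
Import Order.TTheory GRing.Theory Num.Theory.

(** The k-th entry of the Lehmer code of w is read off from the one-line
    notation.  If the letter with absolute value k is positive, the entry is the
    number of letters of smaller absolute value to its right; if it is negative,
    the entry is k plus the number of such letters to its left ([code],
    [lehmerE]; in the code below letters are numbered from 0).  Indeed the k-th
    factor of w inserts the letter k into a signed permutation of the smaller
    letters, walking from the right end to the left end with a plus sign and then
    back with a minus sign, one step per simple reflection; the later factors
    insert larger letters and do not disturb the smaller ones.

    The rbg condition ([growth]) lets a code start with a run of maximal entries
    1, 3, 5, ..., possibly empty; after the first entry that is not maximal, every
    later letter is positive.  Call an index i nonmaximal when a_i < 2i - 1.  For
    an rbg tuple a, the elements u with code(u) <= a are exactly those whose entries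
    satisfy, at every position q and for every nonmaximal i, an upper bound
    u_q < i when q < i - a_i and a lower bound u_q > -i when a_i < i + q - 1
    ([bounded], [code_bounded], [bounded_code]).  Going from left to right the
    upper bounds only get weaker and the lower bounds only get stronger, and
    every upper bound i comes with a lower bound -i at all positions; hence these
    conditions survive every downward step of the Bruhat order: a step moves a
    larger value to the right, replaces two entries x, y with negative sum by
    -y, -x, or makes a negative entry positive ([bounded_step]).  So an element with an rbg code is principal
    ([growth_code_le]).

    Conversely, when the code of w breaks the rbg condition at consecutive
    letters h and h + 1, the relative position of these two letters and of a
    well-chosen smaller one takes one of four shapes ([growth_defect]).  Each
    shape is an occurrence of one of the eight patterns ([defect_contains]), and
    each allows one or two downward reflections that increase the entry of the
    code at h ([defect_rise]), so w is not principal.  That an rbg code excludes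
    the patterns follows again from the description by bounds ([growth_avoids]).

    Since codes fill the whole box of tuples with 0 <= a_i <= 2i - 1
    ([code_seq_box], injectivity and a cardinality count), the principal elements
    are counted by the rbg tuples.  After the first nonmaximal entry these are
    lattice-path sequences, counted by ballot numbers, and the initial run of
    maximal entries telescopes ([size_chains_max]). *)

(** * One-line notation, signed reflections and the exchange property *)

Lemma entryE n (w : signed_perm n) i :
  entry w i = if sp_neg w i then (- (sp_abs w i).+1%:Z)%R else (sp_abs w i).+1%:Z%R.
Proof. by rewrite /entry; case: (sp_neg w i); rewrite ?mulN1r ?mul1r. Qed.

Lemma absz_entry n (w : signed_perm n) i : `|entry w i|%N = (sp_abs w i).+1.
Proof. by rewrite entryE; case: ifP => _; lia. Qed.

Lemma entry_inj n (u v : signed_perm n) : entry u =1 entry v -> u = v.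
Proof.
move=> E; apply: signed_permP => [|i].
  apply/permP=> i; apply/val_inj/eqP; rewrite -eqSS.
  by rewrite -!absz_entry E.
by move: (E i); rewrite !entryE; case: (sp_neg u i); case: (sp_neg v i) => //; lia.
Qed.

Lemma entryM n (u v : signed_perm n) i :
  entry (u * v)%g i = ((-1) ^+ sp_neg v i * entry u (sp_abs v i))%R.
Proof. by rewrite /entry /= ffunE permM signr_addb mulrA. Qed.

(** All reflections of the group in one family: for [e = false] the swap of the
    entries at [q] and [r], for [e = true] the swap with both signs changed,
    which for [q = r] is the sign change of a single entry. *)
Definition refl n (q r : 'I_n) (e : bool) : signed_perm n :=
  SignedPerm (tperm q r) [ffun i => e && ((i == q) || (i == r))].

Lemma entry_reflL n (w : signed_perm n) q r e :
  entry (w * refl q r e)%g q = ((-1) ^+ e * entry w r)%R.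
Proof. by rewrite entryM /= ffunE eqxx andbT tpermL. Qed.

Lemma entry_reflR n (w : signed_perm n) q r e :
  entry (w * refl q r e)%g r = ((-1) ^+ e * entry w q)%R.
Proof. by rewrite entryM /= ffunE eqxx orbT andbT tpermR. Qed.

Lemma entry_reflD n (w : signed_perm n) q r e i :
  i != q -> i != r -> entry (w * refl q r e)%g i = entry w i.
Proof.
move=> iq ir; rewrite entryM /= ffunE (negbTE iq) (negbTE ir) andbF mul1r.
by rewrite tpermD // eq_sym.
Qed.

Lemma reflK n (w : signed_perm n) q r e : (w * refl q r e * refl q r e = w)%g.
Proof.
apply: entry_inj => i; have [->|iq] := eqVneq i q.
  by rewrite entry_reflL entry_reflR mulrA -expr2 sqrr_sign mul1r.
have [->|ir] := eqVneq i r.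
  by rewrite entry_reflR entry_reflL mulrA -expr2 sqrr_sign mul1r.
by rewrite !entry_reflD.
Qed.

(** The action on the values 1, -1, 2, -2, ... of left multiplication by the
    simple reflection with index [j]. *)
Definition simple_act (j : nat) (x : int) : int :=
  if j == 0 then (if `|x|%N == 1 then (- x)%R else x)
  else if `|x|%N == j then (x + sgz x)%R
  else if `|x|%N == j.+1 then (x - sgz x)%R else x.

Lemma simple_actN j x : simple_act j (- x) = (- simple_act j x)%R.
Proof. by rewrite /simple_act abszN sgzN; do ![case: ifP => _]; rewrite ?opprD. Qed.

Lemma simple_actZ j (e : bool) x : simple_act j ((-1) ^+ e * x) = ((-1) ^+ e * simple_act j x)%R.
Proof. by case: e; rewrite ?mulN1r ?mul1r // simple_actN. Qed.

(** Only the two values that a simple reflection exchanges, or their negatives,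
    can be put in the wrong order by it: the simple reflection makes its simple
    root negative and no other positive root. *)
Lemma simple_act_cross j (x y : int) : x != 0 -> y != 0 ->
    (y < x)%R -> (simple_act j x < simple_act j y)%R ->
  [/\ simple_act j y = x, simple_act j x = y
    & forall z : int, `|z|%N != `|x|%N -> `|z|%N != `|y|%N -> simple_act j z = z].
Proof.
move=> x0 y0 yx; rewrite /simple_act; case: (eqVneq j 0) => [_|j0];
  do ![case: eqP => ? //]; move=> C; split=> [| |z zx zy];
  do ?[case: eqP => ?]; lia.
Qed.

Lemma ord_predE n (j : 'I_n) : 0 < j -> ord_pred j = j.-1 :> nat.
Proof.
move=> j0; rewrite /= -{1}[j : nat]prednK //= modnDr modn_small //.
by have := ltn_ord j; lia.
Qed.

Lemma entry_simpleM n (j : 'I_n) (w : signed_perm n) i :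
  entry (simple j * w)%g i = simple_act j (entry w i).
Proof.
rewrite entryM [entry w i]/entry simple_actZ; congr (_ * _)%R.
rewrite /simple /simple_act; case: (eqVneq (j : nat) 0) => [j0|j0].
  rewrite entryE /= ffunE perm1 -val_eqE /= j0 eqSS.
  by case: eqP => E //; lia.
have jE : ord_pred j = j.-1 :> nat by rewrite ord_predE // lt0n.
rewrite entryE /= ffunE; case: tpermP => [->|->|]; rewrite ?jE.
- by do ![case: eqP => ?]; lia.
- by do ![case: eqP => ?]; lia.
move=> /eqP; rewrite -val_eqE /= -[(_ %% _)]/(ord_pred j : nat) jE => A.
by move=> /eqP; rewrite -val_eqE /= => B; do ![case: eqP => ?]; lia.
Qed.

Lemma has_wordP n (w : signed_perm n) m :
  reflect (exists2 s : seq 'I_n, size s = m & w = (\prod_(i <- s) simple i)%g)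
          (has_word w m).
Proof.
apply: (iffP existsP) => [[t /eqP ->]|[s <- ->]]; first by exists t; rewrite ?size_tuple.
by exists (in_tuple s).
Qed.

Lemma has_word_length n (w : signed_perm n) : has_word w (length w).
Proof. by rewrite /length; case: ex_minnP. Qed.

Lemma length_min n (w : signed_perm n) m : has_word w m -> length w <= m.
Proof. by rewrite /length; case: ex_minnP => k _; apply. Qed.

Lemma entry_neq0 n (w : signed_perm n) i : entry w i != 0.
Proof. by rewrite -absz_eq0 absz_entry. Qed.

Lemma absz_entry_eq n (w : signed_perm n) i j :
  (`|entry w i|%N == `|entry w j|%N) = (i == j).
Proof. by rewrite !absz_entry eqSS val_eqE (inj_eq perm_inj). Qed.

(** The exchange property, for a reflection [t] with w(alpha_t) < 0, without a
    formula for the length.  Remove the letters of the word from the left: either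
    the root is still negative for the shorter word, or the removed letter [j]
    changes its sign; then it acts on the values as [t] does on the positions,
    and [w t] is the shorter word. *)
Lemma exchange n (s : seq 'I_n) (q r : 'I_n) (e : bool) :
    ((q == r) ==> e) ->
    let w := (\prod_(i <- s) simple i)%g in
    (q <= r) -> (entry w r < (-1) ^+ e * entry w q)%R ->
  exists2 s', size s' < size s & (w * refl q r e = \prod_(i <- s') simple i)%g.
Proof.
move=> qre w leqr; rewrite {}/w.
elim: s => [|j s IH].
  rewrite big_nil !entryE /= !ffunE !perm1.
  case: e qre => [_|]; first by rewrite mulN1r; lia.
  by rewrite mul1r implybF => _; lia.
rewrite big_cons; set w := (\prod_(i <- s) _)%g in IH *.
rewrite !entry_simpleM -simple_actZ => down.
case: (ltrP (entry w r) ((-1) ^+ e * entry w q)) => [/IH[s' lts E]|up].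
  by exists (j :: s'); rewrite //= big_cons -E mulgA.
(* Equality up to sign forces [q = r], hence [e], and the entry would be 0. *)
have neqe : ((-1) ^+ e * entry w q != entry w r)%R.
  apply/eqP=> E; have /eqP := congr1 absz E.
  rewrite abszMsign absz_entry_eq => /eqP qr; move: qre E; rewrite qr eqxx /= => ->.
  by rewrite mulN1r => E; have := entry_neq0 w r; lia.
have lte : ((-1) ^+ e * entry w q < entry w r)%R by rewrite lt_neqAle neqe.
have n0 : ((-1) ^+ e * entry w q != 0)%R.
  by rewrite -absz_eq0 abszMsign absz_entry.
have [Eq Er Ez] := simple_act_cross (entry_neq0 w r) n0 lte down.
exists s; rewrite //= -[RHS]/w; apply: entry_inj => i.
have [->|iq] := eqVneq i q.
  by rewrite entry_reflL entry_simpleM Er mulrA -expr2 sqrr_sign mul1r.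
have [->|ir] := eqVneq i r; first by rewrite entry_reflR entry_simpleM -simple_actZ.
rewrite entry_reflD // entry_simpleM Ez //; last rewrite abszMsign.
  by rewrite absz_entry_eq.
by rewrite absz_entry_eq.
Qed.

Lemma length_refl n (w : signed_perm n) (q r : 'I_n) (e : bool) :
    ((q == r) ==> e) -> q <= r -> (entry w r < (-1) ^+ e * entry w q)%R ->
  length (w * refl q r e)%g < length w.
Proof.
move=> qre leqr; have /has_wordP[s <- ->] := has_word_length w.
move=> /(exchange qre leqr)[s' lts ->].
by apply: leq_ltn_trans lts; apply/length_min/has_wordP; exists s'.
Qed.

Lemma reflC n (q r : 'I_n) e : refl q r e = refl r q e.
Proof.
apply: signed_permP => [|i]; first by rewrite /= tpermC.
by rewrite !ffunE orbC.
Qed.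

(** * Reflections and Bruhat steps *)

Lemma refl_conj n (w : signed_perm n) q r e :
  (refl (sp_abs w q) (sp_abs w r) e ^ w =
   refl q r (e (+) sp_neg w q (+) sp_neg w r))%g.
Proof.
rewrite conjgE; apply: (canLR (mulKg w)); apply: signed_permP => [|i] /=.
  by rewrite -tpermJ conjgE !mulgA mulgV mul1g.
rewrite !ffunE !(inj_eq perm_inj).
have [->|iq] := eqVneq i q.
  by rewrite tpermL /=; case: e; case: (sp_neg w q); case: (sp_neg w r).
have [->|ir] := eqVneq i r.
  by rewrite tpermR /= !andbT; case: e; case: (sp_neg w q); case: (sp_neg w r).
by rewrite tpermD 1?eq_sym // !andbF addbF.
Qed.

Lemma simple0E n (j : 'I_n) : j = 0 :> nat -> simple j = refl j j true.
Proof.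
move=> j0; rewrite /simple j0 eqxx.
by apply: signed_permP => [|i]; rewrite /= ?tperm1 // !ffunE orbb.
Qed.

Lemma simpleSE n (j : 'I_n) : 0 < j -> simple j = refl (ord_pred j) j false.
Proof. by move=> j0; rewrite /simple gtn_eqF. Qed.

Lemma simpleE n (j : 'I_n) :
  exists q r e, ((q == r) ==> e) /\ simple j = refl q r e.
Proof.
have [j0|j0] := posnP j; first by exists j, j, true; rewrite implybT simple0E.
exists (ord_pred j), j, false; rewrite simpleSE //; split=> //.
by rewrite implybF -val_eqE [val _]ord_predE //=; lia.
Qed.

Lemma reflectionsE n (t : signed_perm n) : t \in reflections n ->
  exists (q r : 'I_n) e, [/\ (q == r) ==> e, q <= r & t = refl q r e].
Proof.
case/imset2P => _ w /imsetP[j _ ->] _ ->.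
suff [q [r [e [qre ->]]]] : exists (q r : 'I_n) e, (q == r) ==> e /\ (simple j ^ w)%g = refl q r e.
  case: (leqP q r) => [le|/ltnW le]; first by exists q, r, e.
  by exists r, q, e; rewrite reflC eq_sym.
have [q [r [e [qre ->]]]] := simpleE j.
rewrite -(permKV (sp_abs w) q) -(permKV (sp_abs w) r) refl_conj.
set q' := (sp_abs w)^-1%g q; set r' := (sp_abs w)^-1%g r; exists q', r'; eexists; split; last by [].
apply/implyP => /eqP E; move: qre; rewrite -(inj_eq (@perm_inj _ (sp_abs w)^-1)).
by rewrite -/q' -/r' E eqxx /= => ->; rewrite -addbA addbb.
Qed.

Lemma refl_in_reflections n (q r : 'I_n) e :
  ((q == r) ==> e) -> refl q r e \in reflections n.
Proof.
have [->|neqr] /= := eqVneq q r.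
  move=> ->; have z : 0 < n by apply: leq_ltn_trans (ltn_ord r).
  pose o := Ordinal z; pose w := inj_perm (tperm r o).
  have wr : sp_abs w r = o by rewrite /= tpermL.
  apply/imset2P; exists (simple o) w => //.
    by apply/imsetP; exists o.
  rewrite simple0E //.
  by rewrite -wr refl_conj !ffunE.
move=> _; have n1 : 1 < n.
  by case: n q r neqr => [[]//|[|//]] q r; rewrite !ord1 eqxx.
pose z := Ordinal (ltnW n1); pose o := Ordinal n1.
pose s := (tperm q z * tperm (tperm q z r) o)%g.
have sq : s q = z.
  rewrite permM tpermL tpermD //; apply/eqP => /(canRL (tpermK _ _)).
  by rewrite tpermR => /eqP; rewrite eq_sym (negbTE neqr).
have sr : s r = o by rewrite permM tpermL.
pose w := SignedPerm s [ffun i => e && (i == q)].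
apply/imset2P; exists (simple o) w => //; first by apply/imsetP; exists o.
have -> : simple o = refl z o false.
  apply: signed_permP => [|i]; rewrite /= ?ffunE // /simple /=.
  by congr tperm; apply/val_inj; rewrite /= modnn.
rewrite -sq -sr (refl_conj w) /= !ffunE eqxx andbT [r == q]eq_sym (negbTE neqr).
by rewrite andbF addbF.
Qed.

Lemma bruhat_step_refl n (w : signed_perm n) (q r : 'I_n) e :
    ((q == r) ==> e) -> q <= r -> (entry w r < (-1) ^+ e * entry w q)%R ->
  bruhat_step (w * refl q r e)%g w.
Proof.
move=> qre le down; rewrite /bruhat_step length_refl //=.
by apply/exists_inP; exists (refl q r e); rewrite ?reflK ?refl_in_reflections.
Qed.

(** By [length_refl], the opposite strict inequality would make [v] shorter than
    [u]. *)
Lemma bruhat_stepE n (u v : signed_perm n) : bruhat_step u v ->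
  exists (q r : 'I_n) e, [/\ q <= r, (q == r) ==> e, u = (v * refl q r e)%g
                  & (entry v r <= entry u r)%R].
Proof.
case/andP => ltuv /exists_inP[t /reflectionsE[q [r [e [qre le ->]]]] /eqP vE].
have uE : u = (v * refl q r e)%g by rewrite vE reflK.
exists q, r, e; split=> //; rewrite leNgt; apply/negP => lt.
have := ltn_trans ltuv; rewrite vE => /(_ _ (length_refl qre le _)).
rewrite ltnn; move: lt; rewrite vE entry_reflR => lt /(_ lt) //.
Qed.

(** * Insertion codes and the downward closed sets they bound *)

Lemma card_ltn n m : m <= n -> #|[set q : 'I_n | q < m]| = m.
Proof.
move=> lemn; have inj : injective (widen_ord lemn).
  by move=> x y /(congr1 val) /= /val_inj.
rewrite -[RHS]card_ord -(card_imset _ inj).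
apply: eq_card => q; rewrite inE; apply/idP/imsetP => [lt|[p _ ->]]; last exact: (ltn_ord p).
by exists (Ordinal lt) => //; apply: val_inj.
Qed.

Definition pos n (w : signed_perm n) (k : 'I_n) : 'I_n := (sp_abs w)^-1%g k.

Definition smaller_left n (w : signed_perm n) (k : 'I_n) : nat :=
  #|[set q : 'I_n | (q < pos w k) && (sp_abs w q < k)]|.

(** The number of steps that bring letter [k] from the right end of the smaller
    letters to its place among them, when it first walks left with a plus sign,
    then changes sign at the left end and walks back right. *)
Definition code n (w : signed_perm n) (k : 'I_n) : nat :=
  if sp_neg w (pos w k) then k.+1 + smaller_left w k else k - smaller_left w k.

Lemma posK n (w : signed_perm n) k : sp_abs w (pos w k) = k.
Proof. exact: permKV. Qed.

Lemma absK n (w : signed_perm n) q : pos w (sp_abs w q) = q.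
Proof. exact: permK. Qed.

Lemma smaller_left_pos n (w : signed_perm n) k : smaller_left w k <= pos w k.
Proof.
rewrite -[leqRHS](@card_ltn n); last exact/ltnW/ltn_ord.
by rewrite /smaller_left; apply/subset_leq_card/subsetP => q; rewrite !inE => /andP[].
Qed.

Lemma card_abs_lt n (w : signed_perm n) (k : 'I_n) :
  #|[set q : 'I_n | sp_abs w q < k]| = k.
Proof.
rewrite -[RHS](@card_ltn n); last exact/ltnW/ltn_ord.
rewrite -(card_imset _ (@perm_inj _ (sp_abs w))); apply: eq_card => j.
rewrite [in RHS]inE; apply/imsetP/idP => [[q]|lt]; first by rewrite inE => ? ->.
by exists (pos w j); rewrite ?inE posK.
Qed.

Lemma smaller_left_le n (w : signed_perm n) k : smaller_left w k <= k.
Proof.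
rewrite -[leqRHS](card_abs_lt w k).
by rewrite /smaller_left; apply/subset_leq_card/subsetP => q; rewrite !inE => /andP[].
Qed.

Lemma smaller_left_ge n (w : signed_perm n) (k : 'I_n) m :
    m <= pos w k -> (forall q : 'I_n, q < m -> sp_abs w q < k) ->
  m <= smaller_left w k.
Proof.
move=> le H; rewrite -(@card_ltn n m); last exact: leq_trans (ltnW (ltn_ord (pos w k))).
rewrite /smaller_left; apply/subset_leq_card/subsetP => q; rewrite !inE => lt.
by rewrite (leq_trans lt le) H.
Qed.

Lemma smaller_left_gt n (w : signed_perm n) (k : 'I_n) m (x : 'I_n) :
    m <= x -> x < pos w k -> sp_abs w x < k ->
    (forall q : 'I_n, q < m -> sp_abs w q < k) ->
  m < smaller_left w k.
Proof.
move=> lemx ltx xk H; rewrite -{1}(@card_ltn n m); last exact: leq_trans (ltnW (ltn_ord x)).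
rewrite /smaller_left; apply/proper_card/properP; split.
  apply/subsetP => q; rewrite !inE => lt.
  by rewrite (leq_trans lt) ?H // (leq_trans lemx (ltnW ltx)).
by exists x; rewrite !inE ?ltx // -leqNgt.
Qed.

Lemma code_le n (w : signed_perm n) (k : 'I_n) : code w k <= (2 * k).+1.
Proof. by rewrite /code; have := smaller_left_le w k; case: ifP => _; lia. Qed.

Lemma code_neg n (w : signed_perm n) (k : 'I_n) : (k < code w k) = sp_neg w (pos w k).
Proof. by rewrite /code; have := smaller_left_le w k; case: ifP => _; lia. Qed.

(** For an rbg tuple [a], the one-line description of the elements with code at
    most [a].  The letter
    numbered [i] has absolute value [i.+1], and [(2 * i).+1] is the maximal entry. *)
Definition bounded n (a : 'I_n -> nat) (u : signed_perm n) : Prop :=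
  forall i q : 'I_n, a i < (2 * i).+1 ->
    (a i + q < i -> (entry u q < i.+1%:Z)%R) /\
    (a i < i.+1 + q -> (- i.+1%:Z < entry u q)%R).

(** At the position of letter [i] the bound that its entry violates must be
    inactive.  For a negative letter this is the required inequality.  For a
    positive one, both bounds are active at the leftmost [i - a i] positions, so
    that these hold smaller letters, all to the left of letter [i]. *)
Lemma bounded_code n (a : 'I_n -> nat) u :
  bounded a u -> forall i, code u i <= a i.
Proof.
move=> B i; case: (ltnP (a i) (2 * i).+1) => [nmax|]; last exact/leq_trans/code_le.
have [] := B i (pos u i) nmax; rewrite entryE posK /code.
have := smaller_left_pos u i; case: ifP => _ Lp; first by move=> _ ; lia.
move=> Bp _; case: (leqP i (a i)) => ai; first by lia.

have : i - a i <= smaller_left u i; last by lia.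
apply: smaller_left_ge => [|q ltq]; first by lia.
have [Bq Bq'] := B i q nmax; move: Bq Bq'; rewrite entryE; case: ifP => _; lia.
Qed.

(** The rbg condition on nonnegative integers.  The bound [(2 * h).+1] is the
    maximal entry at [h], that is 2i - 3 for the 1-based index i = h + 2. *)
Definition growth n (a : 'I_n -> nat) : Prop :=
  forall h i : 'I_n, i = h.+1 :> nat -> a h < (2 * h).+1 ->
    a i <= (a h).+1 /\ a i + a h <= (2 * h).+1.

(** For the letter after [h] the two bounds add up to [2 * a i <= 2 * i]: its
    entry is not maximal either, so that the growth by at most one per letter
    continues, and by [code_neg] the letter is positive when [a] is a code. *)
Lemma growth_lt n (a : 'I_n -> nat) (h i : 'I_n) :
    growth a -> h < i -> a h < (2 * h).+1 ->
  [/\ a i <= i, a i <= a h + (i - h) & a i + a h <= i + h].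
Proof.
move=> G; case: i => i lti /=; elim: i lti => // i IH lti.
rewrite ltnS leq_eqVlt => /predU1P[hi|lthi] nmax.
  by have [g1 g2] := G h (Ordinal lti) (esym (congr1 succn hi)) nmax; split; lia.
have [h1 h2 h3] := IH (ltnW lti) lthi nmax.
have := G (Ordinal (ltnW lti)) (Ordinal lti) erefl; rewrite /= => /(_ _)[|g1 g2]; first by lia.
by split; lia.
Qed.

(** A letter [j] that breaks a bound of index [i <= j] stands too far left when
    it is positive, against [growth_lt]; when it is negative it must be [i].  In
    the last case the positions before [a i - i] hold only letters below [i],
    because a larger letter there would contradict the bound on the sum of its
    entry and [a i]. *)
Lemma code_bounded n (a : 'I_n -> nat) u :
  growth a -> (forall i, code u i <= a i) -> bounded a u.
Proof.
move=> G C i q nmax; pose j := sp_abs u q.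
have jq : pos u j = q by rewrite absK.
have Lj := smaller_left_pos u j; rewrite jq in Lj.
have Lj' := smaller_left_le u j.
have := C j; rewrite /code jq entryE -/j => Cj.
split=> H; rewrite ltNge; apply/negP; case: ifP Cj => // sg Cj le; try lia.
  have [eij|ltij|eij] := ltngtP i j; try lia.
    by have [] := growth_lt G eij nmax; lia.
  by move: H nmax; rewrite (val_inj eij); lia.
have [lt|lt|eij] := ltngtP i j; try lia.
  by have [] := growth_lt G lt nmax; lia.
move/val_inj: eij => eij; rewrite -eij in jq Lj Lj' Cj.
suff: a i - i <= smaller_left u i by lia.
apply: smaller_left_ge => [|p ltp]; first by rewrite jq; lia.
rewrite ltnNge; apply/negP => lep.
set k := sp_abs u p in lep; have pk : pos u k = p by rewrite absK.
have neik : i != k :> nat.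
  by apply/eqP => /val_inj E; move: pk ltp; rewrite -E jq => <-; lia.
have ltik : i < k by lia.
have [k1 k2 k3] := growth_lt G ltik nmax.
have := C k; rewrite /code pk; case: ifP => _; first by lia.
by have := smaller_left_pos u k; rewrite pk; lia.
Qed.

(** No condition on [a] is needed: the upper bounds weaken and the lower bounds
    strengthen from left to right, and an active upper bound [i] comes with the
    lower bound [- i] at all positions, because then [a i < i]. *)
Lemma bounded_step n (a : 'I_n -> nat) (u v : signed_perm n) :
  bruhat_step u v -> bounded a v -> bounded a u.
Proof.
case/bruhat_stepE => q [r [e [leqr qre uE le]]] B i p nmax.
have [Bq Bq'] := B i q nmax; have [Br Br'] := B i r nmax.
have uq : entry u q = ((-1) ^+ e * entry v r)%R by rewrite uE entry_reflL.
have ur : entry u r = ((-1) ^+ e * entry v q)%R by rewrite uE entry_reflR.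
have [->|pq] := eqVneq p q.
  by case: e uq ur {qre uE}; rewrite ?mulN1r ?mul1r; split; lia.
have [->|pr] := eqVneq p r.
  by case: e uq ur {qre uE}; rewrite ?mulN1r ?mul1r; split; lia.
by rewrite uE entry_reflD //; apply: B.
Qed.

Lemma bounded_bruhat n (a : 'I_n -> nat) (u w : signed_perm n) :
  bruhat u w -> bounded a w -> bounded a u.
Proof.
case/connectP => p; elim: p u => [|v p IH] u /=; first by move=> _ ->.
by case/andP=> /bounded_step uv vp wE /(IH _ vp wE)/uv.
Qed.

Lemma growth_code_le n (u w : signed_perm n) :
  growth (code w) -> bruhat u w -> forall i, code u i <= code w i.
Proof. by move=> G /bounded_bruhat H; apply/bounded_code/H/code_bounded. Qed.

(** * The four ways of breaking the growth condition *)

(** The possible positions of two consecutive letters [h] and [i = h + 1] at which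
    the code breaks the growth condition; [x] is the position of a smaller letter. *)
Inductive growth_defect n (w : signed_perm n) (h i : 'I_n) : Prop :=
| DefectPosPos (x : 'I_n) of ~~ sp_neg w (pos w h) & ~~ sp_neg w (pos w i) &
    pos w i < x < pos w h & sp_abs w x < h
| DefectPosNeg of ~~ sp_neg w (pos w h) & sp_neg w (pos w i)
| DefectNegAny (x : 'I_n) of sp_neg w (pos w h) &
    pos w i < pos w h < x & sp_abs w x < h
| DefectNegNeg (x : 'I_n) of sp_neg w (pos w h) & sp_neg w (pos w i) &
    pos w h < pos w i & pos w h < x & sp_abs w x < h.

Lemma pos_eq n (w : signed_perm n) (k x : 'I_n) : (x == pos w k) = (sp_abs w x == k).
Proof. by rewrite -[LHS](inj_eq (@perm_inj _ (sp_abs w))) posK. Qed.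

Lemma pos_neq n (w : signed_perm n) (k x : 'I_n) :
  (x != pos w k :> nat) = (sp_abs w x != k :> nat).
Proof. by have /= := congr1 negb (pos_eq w k x); rewrite -!val_eqE. Qed.

Lemma smaller_right n (w : signed_perm n) (h : 'I_n) :
  smaller_left w h < h -> exists2 x : 'I_n, pos w h < x & sp_abs w x < h.
Proof.
rewrite -[ltnRHS](card_abs_lt w h) ltnNge => /negP N.
apply/exists_inP; apply: contraT => /exists_inPn H.
case: N; rewrite /smaller_left; apply/subset_leq_card/subsetP => q; rewrite !inE.
move=> qh; rewrite qh andbT ltn_neqAle leqNgt; apply/andP; split.
  by rewrite pos_neq neq_ltn qh.
by apply/negP => /H; rewrite qh.
Qed.

Lemma growth_defectP n (w : signed_perm n) (h i : 'I_n) :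
    i = h.+1 :> nat -> code w h < (2 * h).+1 ->
    ~~ ((code w i <= (code w h).+1) && (code w i + code w h <= (2 * h).+1)) ->
  growth_defect w h i.
Proof.
move=> ih; have Lh := smaller_left_le w h; have Li := smaller_left_le w i.
have nePQ : pos w h != pos w i :> nat.
  by rewrite pos_neq posK; lia.
rewrite /code; case: ifPn => sh; case: ifPn => si nmax bad.
- have [|x hx xh] := @smaller_right _ w h; first by lia.
  have [lt|lt|/eqP] := ltngtP (pos w h) (pos w i); last by rewrite (negbTE nePQ).
    exact: DefectNegNeg lt hx xh.
  by apply: DefectNegAny xh => //; rewrite lt.
- have [|x hx xh] := @smaller_right _ w h; first by lia.
  apply: DefectNegAny xh => //; rewrite hx andbT.
  have [//|lt|/eqP] := ltngtP (pos w i) (pos w h); last by rewrite eq_sym (negbTE nePQ).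
  suff : smaller_left w h < smaller_left w i by lia.
  apply/proper_card/properP; split.
    apply/subsetP => q; rewrite !inE => /andP[q1 q2]; apply/andP; split; lia.
  by exists (pos w h); rewrite !inE ?posK ?ltnn //; apply/andP; split; lia.
- exact: DefectPosNeg.
have : smaller_left w i < smaller_left w h by lia.
rewrite ltnNge => /negP N.
have [x /andP[x1 x2] xh] : exists2 x : 'I_n, pos w i <= x < pos w h & sp_abs w x < h.
  apply/exists_inP; apply: contraT => /exists_inPn H.
  case: N; rewrite /smaller_left; apply/subset_leq_card/subsetP => q; rewrite !inE.
  case/andP => q1 q2; rewrite ltnNge; apply/andP; split; last by lia.
  by apply/negP => q3; have := H q; rewrite unfold_in q3 q1 => /(_ isT); rewrite q2.
apply: (DefectPosPos (x := x)) (xh) => //; rewrite x2 andbT ltn_neqAle x1 andbT.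
by rewrite eq_sym pos_neq; lia.
Qed.

Lemma abs_refl n (w : signed_perm n) q r e x :
  sp_abs (w * refl q r e)%g x = sp_abs w (tperm q r x).
Proof. by rewrite /= permM. Qed.

Lemma neg_refl n (w : signed_perm n) q r e x :
  sp_neg (w * refl q r e)%g x =
  (e && ((x == q) || (x == r))) (+) sp_neg w (tperm q r x).
Proof. by rewrite /= !ffunE. Qed.

Lemma pos_refl n (w : signed_perm n) q r e k :
  pos (w * refl q r e)%g k = tperm q r (pos w k).
Proof. by rewrite /pos /= invMg tpermV permM. Qed.

Lemma bruhat_step_swap n (w : signed_perm n) (q r : 'I_n) :
  q < r -> (entry w r < entry w q)%R -> bruhat_step (w * refl q r false)%g w.
Proof.
move=> lt down; apply: bruhat_step_refl; rewrite ?mul1r 1?ltnW // implybF.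
by rewrite -val_eqE neq_ltn lt.
Qed.

Lemma bruhat_step_negswap n (w : signed_perm n) (q r : 'I_n) :
  (entry w q + entry w r < 0)%R -> bruhat_step (w * refl q r true)%g w.
Proof.
move=> down; case: (leqP q r) => [le|/ltnW le].
  by apply: bruhat_step_refl; rewrite ?implybT // mulN1r; lia.
by rewrite reflC; apply: bruhat_step_refl; rewrite ?implybT // mulN1r; lia.
Qed.

Lemma tperm_neq_val n (q r x : 'I_n) : x != q :> nat -> x != r :> nat -> tperm q r x = x.
Proof. by move=> xq xr; rewrite tpermD // eq_sym. Qed.

(** Letter [h] stays at its place and a smaller letter moves from its right to
    its left, in exchange for a larger one. *)
Lemma code_refl_gt n (w : signed_perm n) (h q x : 'I_n) e :
    sp_neg w (pos w h) -> q < pos w h < x -> sp_abs w x < h -> h < sp_abs w q ->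
  code w h < code (w * refl q x e)%g h.
Proof.
move=> sh /andP[qh hx] xh hq.
have tP : tperm q x (pos w h) = pos w h by apply: tperm_neq_val; lia.
have : smaller_left w h < smaller_left (w * refl q x e)%g h.
  rewrite /smaller_left; apply/proper_card/properP; split.
    apply/subsetP => y; rewrite !inE pos_refl abs_refl tP => /andP[y1 y2].
    rewrite y1 tperm_neq_val //; first by apply/eqP => /val_inj E; rewrite E in y2; lia.
    by lia.
  exists q; rewrite !inE ?pos_refl ?abs_refl ?tP ?tpermL ?qh ?xh //=; lia.
rewrite /code pos_refl neg_refl !tP sh.
have -> : (pos w h == q) || (pos w h == x) = false.
  by rewrite -!val_eqE /=; lia.
by rewrite andbF /=; lia.
Qed.

(** The reflections: put letter [h] in the place of [i]; do so with a change of
    both signs; or move a smaller letter to the left of the negative letter [h].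
    When [h] and [i] are both negative with [h] on the left, swapping them first
    leads to the third situation, unless it already raises the entry. *)
Lemma defect_rise n (w : signed_perm n) (h i : 'I_n) :
    i = h.+1 :> nat -> growth_defect w h i ->
  exists2 u, bruhat u w & code w h < code u h.
Proof.
move=> ih; have eh : entry w (pos w h) = (if sp_neg w (pos w h) then - h.+1%:Z else h.+1%:Z)%R.
  by rewrite entryE posK.
have ei : entry w (pos w i) = (if sp_neg w (pos w i) then - i.+1%:Z else i.+1%:Z)%R.
  by rewrite entryE posK.
have Lh := smaller_left_le w h.
case=> [x sh si /andP[x1 x2] xh|sh si|x sh /andP[x1 x2] xh|x sh si lt hx xh].
- exists (w * refl (pos w i) (pos w h) false)%g.
    by apply/connect1/bruhat_step_swap; [lia | rewrite ei eh (negbTE sh) (negbTE si); lia].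
  rewrite /code pos_refl neg_refl !tpermR /= tpermL (negbTE sh).
  suff: smaller_left (w * refl (pos w i) (pos w h) false)%g h < smaller_left w h by lia.
  rewrite /smaller_left; apply/proper_card/properP; split.
    apply/subsetP => y; rewrite !inE pos_refl abs_refl tpermR => /andP[y1].
    by rewrite tperm_neq_val; lia.
  by exists x; rewrite !inE ?xh ?x2 // pos_refl tpermR; lia.
- exists (w * refl (pos w h) (pos w i) true)%g.
    by apply/connect1/bruhat_step_negswap; rewrite ei eh (negbTE sh) si; lia.
  apply: (@leq_trans h.+1); first by rewrite /code (negbTE sh); lia.
  by rewrite code_neg pos_refl neg_refl tpermL tpermR eqxx orbT (negbTE sh).
- have iq : h < sp_abs w (pos w i) by rewrite posK; lia.
  exists (w * refl (pos w i) x (sp_neg w (pos w i)))%g; last first.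
    by apply: code_refl_gt; rewrite // x1.
  have ex : (- h.+1%:Z < entry w x < h.+1%:Z)%R by rewrite entryE; case: ifP => _; lia.
  case: ifP ei => _ ei; first by apply/connect1/bruhat_step_negswap; lia.
  by apply/connect1/bruhat_step_swap; lia.
set v := (w * refl (pos w h) (pos w i) false)%g.
have bv : bruhat v w by apply/connect1/bruhat_step_swap; rewrite // eh ei sh si; lia.
have pvh : pos v h = pos w i by rewrite pos_refl tpermL.
have svh : sp_neg v (pos v h) by rewrite pvh neg_refl /= tpermR.
have sub : {subset [set q : 'I_n | (q < pos w h) && (sp_abs w q < h)]
      <= [set q : 'I_n | (q < pos v h) && (sp_abs v q < h)]}.
  move=> y; rewrite !inE pvh abs_refl => /andP[y1 y2].
  by rewrite (ltn_trans y1 lt) tperm_neq_val //; lia.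
have nexi : x != pos w i :> nat by rewrite pos_neq; lia.
have xv : sp_abs v x = sp_abs w x by rewrite abs_refl tperm_neq_val //; lia.
have [xi|ix|/eqP] := ltngtP x (pos w i); last by rewrite (negbTE nexi).
  exists v => //; rewrite /code sh svh ltn_add2l /smaller_left.
  apply/proper_card/properP; split; first exact/subsetP.
  by exists x; rewrite !inE ?pvh ?xv ?xi //; lia.
have vh : sp_abs v (pos w h) = i by rewrite abs_refl tpermL posK.
have evh : entry v (pos w h) = (- i.+1%:Z)%R.
  by rewrite entryE vh neg_refl /= tpermL si.
have evx : (- h.+1%:Z < entry v x < h.+1%:Z)%R.
  by rewrite entryE xv; case: ifP => _; lia.
exists (v * refl (pos w h) x true)%g.
  by apply: connect_trans bv; apply/connect1/bruhat_step_negswap; lia.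
apply: (@leq_ltn_trans (code v h)); last first.
  by apply: code_refl_gt => //; rewrite ?vh ?xv ?pvh ?lt //; lia.
rewrite /code sh svh leq_add2l; exact/subset_leq_card/subsetP.
Qed.

Lemma growth_code_defect n (w : signed_perm n) (h i : 'I_n) :
    i = h.+1 :> nat -> code w h < (2 * h).+1 -> ~ growth_defect w h i ->
  code w i <= (code w h).+1 /\ code w i + code w h <= (2 * h).+1.
Proof.
move=> ih nmax D; apply/andP; apply: contraT => /(growth_defectP ih nmax) //.
Qed.

(** * Signed pattern containment *)

Lemma size_window n (w : signed_perm n) : size (window w) = n.
Proof. by rewrite size_map size_enum_ord. Qed.

Lemma nth_window n (w : signed_perm n) (p : 'I_n) : nth 0%R (window w) p = entry w p.
Proof. by rewrite (nth_map p) ?size_enum_ord // nth_ord_enum. Qed.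

Lemma sg_entry n (w : signed_perm n) p (x : int) : x != 0%R ->
  (Num.sg (entry w p) = Num.sg x) <-> (sp_neg w p = (x < 0)%R).
Proof.
move=> x0; rewrite entryE; split; case: (sp_neg w p); case: (sgrP x) x0 => //;
  rewrite ?sgrN ?gtr0_sg //; lia.
Qed.

Lemma norm_entry_lt n (w : signed_perm n) p q :
  (`|entry w p| < `|entry w q|)%R = (sp_abs w p < sp_abs w q).
Proof. by rewrite -!abszE !absz_entry; lia. Qed.

Lemma contains_windowP n (w : signed_perm n) (v : seq int) : 0%R \notin v ->
  contains (window w) v <-> exists g : 'I_(size v) -> 'I_n,
    [/\ forall j k : 'I_(size v), j < k -> g j < g k,
        forall j, sp_neg w (g j) = (nth 0 v j < 0)%R
      & forall j k, (sp_abs w (g j) < sp_abs w (g k)) =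
                    (`|nth 0 v j| < `|nth 0 v k|)%R].
Proof.
move=> v0.
have vn (j : 'I_(size v)) : nth 0%R v j != 0%R by apply: contraNneq v0 => <-; apply: mem_nth.
have wE (i : 'I_(size (window w))) :
    nth 0%R (window w) i = entry w (cast_ord (size_window w) i).
  by rewrite -nth_window.
split=> [[f [fmono fsg ford]]|[g [gmono gneg gord]]].
  exists (fun j => cast_ord (size_window w) (f j)); split=> [||j k]; first exact: fmono.
    by move=> j; apply/sg_entry => //; rewrite -wE.
  by rewrite -norm_entry_lt -!wE.
exists (fun j => cast_ord (esym (size_window w)) (g j)).
split=> [||j k]; first exact: gmono.
  by move=> j; rewrite /= nth_window; apply/sg_entry.
by rewrite /= !nth_window norm_entry_lt.
Qed.

Lemma contains2P n (w : signed_perm n) (a b : int) : a != 0%R -> b != 0%R ->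
  contains (window w) [:: a; b] <-> exists p q : 'I_n,
    [/\ p < q, sp_neg w p = (a < 0)%R, sp_neg w q = (b < 0)%R,
        (sp_abs w p < sp_abs w q) = (`|a| < `|b|)%R
      & (sp_abs w q < sp_abs w p) = (`|b| < `|a|)%R].
Proof.
move=> a0 b0; rewrite contains_windowP; last by rewrite !inE ![0%R == _]eq_sym negb_or a0.
pose i0 : 'I_2 := ord0; pose i1 : 'I_2 := lift ord0 ord0.
split=> [[g [gmono gneg gord]]|[p [q [pq np nq opq oqp]]]].
  by exists (g i0), (g i1); rewrite !gneg !gord gmono.
exists (tnth [tuple p; q]); split=> [[j ltj] [k ltk]|[j ltj]|[j ltj] [k ltk]];
  rewrite !(tnth_nth p) /=.
- by case: j ltj => [|[|[]]] //=; case: k ltk => [|[|[]]].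
- by case: j ltj => [|[|[]]].
- by case: j ltj => [|[|[]]] //= _; case: k ltk => [|[|[]]] //= _; rewrite ?ltnn ?ltxx.
Qed.

Lemma contains3P n (w : signed_perm n) (a b c : int) : a != 0%R -> b != 0%R -> c != 0%R ->
  contains (window w) [:: a; b; c] <-> exists p q r : 'I_n,
    [/\ p < q < r,
        [/\ sp_neg w p = (a < 0)%R, sp_neg w q = (b < 0)%R & sp_neg w r = (c < 0)%R],
        (sp_abs w p < sp_abs w q) = (`|a| < `|b|)%R /\
        (sp_abs w q < sp_abs w p) = (`|b| < `|a|)%R,
        (sp_abs w p < sp_abs w r) = (`|a| < `|c|)%R /\
        (sp_abs w r < sp_abs w p) = (`|c| < `|a|)%R
      & (sp_abs w q < sp_abs w r) = (`|b| < `|c|)%R /\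
        (sp_abs w r < sp_abs w q) = (`|c| < `|b|)%R].
Proof.
move=> a0 b0 c0; rewrite contains_windowP; last first.
  by rewrite !inE ![0%R == _]eq_sym !negb_or a0 b0.
pose i0 : 'I_3 := ord0; pose i1 : 'I_3 := lift ord0 ord0; pose i2 : 'I_3 := ord_max.
split=> [[g [gmono gneg gord]]|[p [q [r [/andP[pq qr] [np nq nr] [pq1 pq2] [pr1 pr2] [qr1 qr2]]]]]].
  by exists (g i0), (g i1), (g i2); rewrite !gneg !gord !gmono.
exists (tnth [tuple p; q; r]); split=> [[j ltj] [k ltk]|[j ltj]|[j ltj] [k ltk]];
  rewrite !(tnth_nth p) /=.
- case: j ltj => [|[|[|[]]]] //=; case: k ltk => [|[|[|[]]]] //= _ _ _.
  exact: ltn_trans qr.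
- by case: j ltj => [|[|[|[]]]].
- case: j ltj => [|[|[|[]]]] //= _; case: k ltk => [|[|[|[]]]] //= _; by rewrite ?ltnn ?ltxx.
Qed.

Lemma defect_contains n (w : signed_perm n) (h i : 'I_n) :
    i = h.+1 :> nat -> growth_defect w h i ->
  exists2 v, v \in lehmer_patterns & contains (window w) v.
Proof.
move=> ih.
have in2 a b : [:: a; b] \in lehmer_patterns -> a != 0%R -> b != 0%R ->
    (exists p q : 'I_n,
      [/\ p < q, sp_neg w p = (a < 0)%R, sp_neg w q = (b < 0)%R,
          (sp_abs w p < sp_abs w q) = (`|a| < `|b|)%R
        & (sp_abs w q < sp_abs w p) = (`|b| < `|a|)%R]) ->
    exists2 v, v \in lehmer_patterns & contains (window w) v.
  by move=> ? ? ? ?; exists [:: a; b] => //; apply/contains2P.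
have in3 a b c : [:: a; b; c] \in lehmer_patterns ->
    a != 0%R -> b != 0%R -> c != 0%R ->
    (exists p q r : 'I_n,
    [/\ p < q < r,
        [/\ sp_neg w p = (a < 0)%R, sp_neg w q = (b < 0)%R & sp_neg w r = (c < 0)%R],
        (sp_abs w p < sp_abs w q) = (`|a| < `|b|)%R /\
        (sp_abs w q < sp_abs w p) = (`|b| < `|a|)%R,
        (sp_abs w p < sp_abs w r) = (`|a| < `|c|)%R /\
        (sp_abs w r < sp_abs w p) = (`|c| < `|a|)%R
      & (sp_abs w q < sp_abs w r) = (`|b| < `|c|)%R /\
        (sp_abs w r < sp_abs w q) = (`|c| < `|b|)%R]) ->
    exists2 v, v \in lehmer_patterns & contains (window w) v.
  by move=> ? ? ? ? ?; exists [:: a; b; c] => //; apply/contains3P.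
have gt2lt a b : a < b -> ((a < b) = true) * ((b < a) = false).
  by move=> lt; split=> //; apply: leq_gtF (ltnW lt).
have lthi : h < i by rewrite ih.
case=> [x /negbTE sh /negbTE si /andP[x1 x2] xh|/negbTE sh si
  |x sh /andP[x1 x2] xh|x sh si lt hx xh].
- have xi := ltn_trans xh lthi.
  case sx: (sp_neg w x); [apply: (in3 3 (-1) 2)%R|apply: (in3 3 1 2)%R];
    rewrite //; exists (pos w i), x, (pos w h); rewrite !posK x1 x2 si sh sx;
    by rewrite !(gt2lt _ _ xi) !(gt2lt _ _ xh) !(gt2lt _ _ lthi).
- have [lt|lt|E] := ltngtP (pos w h) (pos w i).
  + apply: (in2 1 (-2))%R; rewrite //; exists (pos w h), (pos w i).
    by rewrite !posK lt sh si !(gt2lt _ _ lthi).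
  + apply: (in2 (-2) 1)%R; rewrite //; exists (pos w i), (pos w h).
    by rewrite !posK lt sh si !(gt2lt _ _ lthi).
  by move: sh; rewrite (val_inj E) si.
- have xi := ltn_trans xh lthi.
  case sx: (sp_neg w x); last first.
    apply: (in2 (-2) 1)%R; rewrite //; exists (pos w h), x.
    by rewrite !posK x2 sh sx !(gt2lt _ _ xh).
  case si: (sp_neg w (pos w i)); [apply: (in3 (-3) (-2) (-1))%R|apply: (in3 3 (-2) (-1))%R];
    rewrite //; exists (pos w i), (pos w h), x; rewrite !posK x1 x2 si sh sx;
    by rewrite !(gt2lt _ _ xi) !(gt2lt _ _ xh) !(gt2lt _ _ lthi).
have xi := ltn_trans xh lthi.
case sx: (sp_neg w x); last first.
  apply: (in2 (-2) 1)%R; rewrite //; exists (pos w h), x.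
  by rewrite !posK hx sh sx !(gt2lt _ _ xh).
have [lt'|lt'|E] := ltngtP x (pos w i).
- apply: (in3 (-2) (-1) (-3))%R; rewrite //; exists (pos w h), x, (pos w i).
  rewrite !posK lt' hx si sh sx.
  by rewrite !(gt2lt _ _ xi) !(gt2lt _ _ xh) !(gt2lt _ _ lthi).
- apply: (in3 (-2) (-3) (-1))%R; rewrite //; exists (pos w h), (pos w i), x.
  rewrite !posK lt' lt si sh sx.
  by rewrite !(gt2lt _ _ xi) !(gt2lt _ _ xh) !(gt2lt _ _ lthi).
by move: xi; rewrite (val_inj E) posK ltnn.
Qed.

Lemma code_lt_pos n (w : signed_perm n) (q : 'I_n) : ~~ sp_neg w q ->
  code w (sp_abs w q) < (2 * sp_abs w q).+1.
Proof. by move=> /negbTE sq; rewrite /code absK sq; lia. Qed.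

Lemma code_lt_right n (w : signed_perm n) (q r : 'I_n) :
  q < r -> sp_abs w r < sp_abs w q -> code w (sp_abs w q) < (2 * sp_abs w q).+1.
Proof.
move=> qr rq; have L : smaller_left w (sp_abs w q) < sp_abs w q.
  rewrite -[ltnRHS](card_abs_lt w); apply/proper_card/properP; split.
    by apply/subsetP => y; rewrite !inE => /andP[].
  by exists r; rewrite !inE ?rq // absK; lia.
by rewrite /code; case: ifP => _; lia.
Qed.

Lemma growth_neg n (w : signed_perm n) (p q : 'I_n) : growth (code w) ->
  sp_abs w p < sp_abs w q -> code w (sp_abs w p) < (2 * sp_abs w p).+1 ->
  ~~ sp_neg w q.
Proof.
move=> G lt nmax; have [le _ _] := growth_lt G lt nmax.
by move: le; rewrite leqNgt code_neg absK.
Qed.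

(** For the pattern 3 -2 -1: by the lower bounds, only smaller letters stand to the
    left of the negative letter [sp_abs w q], and then the sum bound of
    [growth_lt] forces the larger positive letter to its right. *)
Lemma growth_avoids_321 n (w : signed_perm n) (p q r : 'I_n) :
    growth (code w) -> p < q < r ->
    ~~ sp_neg w p -> sp_neg w q -> sp_abs w r < sp_abs w q < sp_abs w p -> False.
Proof.
move=> G /andP[pq qr] /negbTE np nq /andP[rq qp].
have B := code_bounded G (fun i => leqnn (code w i)).
have nmax := code_lt_right qr rq.
have [_ _] := growth_lt G qp nmax; have [_] := B _ q nmax.
rewrite /code !absK np nq entryE nq.
have := smaller_left_pos w (sp_abs w p); have := smaller_left_le w (sp_abs w p).
by rewrite absK; lia.
Qed.

(** For the patterns 3 1 2 and 3 -1 2, ending in the letter [b]: if [l] smaller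
    letters precede [b], the bounds of index [b] say that they fill the first [l]
    positions; so no smaller letter can stand between a larger one and [b]. *)
Lemma growth_avoids_312 n (w : signed_perm n) (p q r : 'I_n) :
    growth (code w) -> p < q < r ->
    ~~ sp_neg w r -> sp_abs w q < sp_abs w r < sp_abs w p -> False.
Proof.
move=> G /andP[pq qr] nr /andP[aqr arp].
have B := code_bounded G (fun i => leqnn (code w i)).
have nmax := code_lt_pos nr; set b := sp_abs w r in aqr arp nmax *.
have cb : code w b = b - smaller_left w b by rewrite /code absK (negbTE nr).
have small (y : 'I_n) : y < smaller_left w b -> sp_abs w y < b.
  have [] := B b y nmax; have := smaller_left_le w b.
  by rewrite cb entryE; case: ifP => _; lia.
suff : smaller_left w b < smaller_left w b by rewrite ltnn.
apply: (@smaller_left_gt _ _ _ _ q) => //; last by rewrite absK.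
rewrite leqNgt; apply/negP => lt.
by have := small p (ltn_trans pq lt); lia.
Qed.

(** In the first five patterns a negative letter has a larger absolute value than
    some letter with a nonmaximal entry, which [growth_neg] excludes. *)
Lemma growth_avoids n (w : signed_perm n) v :
  growth (code w) -> v \in lehmer_patterns -> avoids (window w) v.
Proof.
move=> G; have neg_above p q : sp_neg w q -> sp_abs w p < sp_abs w q ->
    code w (sp_abs w p) < (2 * sp_abs w p).+1 -> False.
  by move=> nq lt /(growth_neg G lt); rewrite nq.
rewrite !inE; do ![case/orP]; move=> /eqP ->.
- case/contains2P => // p [q [pq np nq _ qp]].
  by apply: (neg_above q p); rewrite ?np ?qp // code_lt_pos ?nq.
- case/contains2P => // p [q [pq np nq qp _]].
  by apply: (neg_above p q); rewrite ?nq ?qp // code_lt_pos ?np.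
- case/contains3P => // p [q [r [/andP[pq qr] [np nq nr] [_ qp] _ [_ rq]]]].
  by apply: (neg_above q p); rewrite ?np ?qp // (code_lt_right qr) ?rq.
- case/contains3P => // p [q [r [/andP[pq qr] [np nq nr] [qp _] [_ rp] _]]].
  by apply: (neg_above p q); rewrite ?nq ?qp // (code_lt_right (ltn_trans pq qr)) ?rp.
- case/contains3P => // p [q [r [/andP[pq qr] [np nq nr] [_ qp] [rp _] _]]].
  by apply: (neg_above p r); rewrite ?nr ?rp // (code_lt_right pq) ?qp.
- case/contains3P => // p [q [r [pqr [np nq nr] [_ qp] _ [_ rq]]]].
  by apply: (growth_avoids_321 G pqr); rewrite ?np ?nq ?qp ?rq.
- case/contains3P => // p [q [r [pqr [np nq nr] _ [_ rp] [qr _]]]].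
  by apply: (growth_avoids_312 G pqr); rewrite ?nr ?qr ?rp.
- case/contains3P => // p [q [r [pqr [np nq nr] _ [_ rp] [qr _]]]].
  by apply: (growth_avoids_312 G pqr); rewrite ?nr ?qr ?rp.
Qed.

(** * Minimal coset representatives as insertions *)

Definition fixes_from n (m : nat) (x : signed_perm n) : bool :=
  [forall q : 'I_n, (m <= q) ==> (sp_abs x q == q) && ~~ sp_neg x q].

Lemma fixes_fromP n m (x : signed_perm n) :
  reflect (forall q : 'I_n, m <= q -> sp_abs x q = q /\ sp_neg x q = false)
          (fixes_from m x).
Proof.
apply: (iffP forall_inP) => F q /F; first by case/andP => /eqP -> /negbTE ->.
by case=> -> ->; rewrite eqxx.
Qed.

Lemma fixes_from_group n m : group_set [set x : signed_perm n | fixes_from m x].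
Proof.
apply/group_setP; split=> [|x y].
  by rewrite inE; apply/fixes_fromP => q _; rewrite /= perm1 ffunE.
rewrite !inE => /fixes_fromP Fx /fixes_fromP Fy; apply/fixes_fromP => q le.
by rewrite /= permM ffunE; have [-> ->] := Fy q le; have [-> ->] := Fx q le.
Qed.

Lemma parabolic_fixes n m (x : signed_perm n) : x \in parabolic n m -> fixes_from m x.
Proof.
suff : parabolic n m \subset Group (fixes_from_group n m).
  by move/subsetP => sub /sub; rewrite inE.
rewrite gen_subG; apply/subsetP => y /imsetP[j]; rewrite !inE => ltjm ->.
apply/fixes_fromP => q le; rewrite /simple; case: (posnP j) => [j0|j0].
  by rewrite /= perm1 ffunE; split=> //; apply/eqP => E; rewrite E in le; lia.
have predE := ord_predE j0; rewrite /= ffunE tpermD //.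
  by apply/eqP => E; rewrite -E in le; lia.
by apply/eqP => E; rewrite -E in le; lia.
Qed.

Lemma parabolic_abs_lt n m (x : signed_perm n) (q : 'I_n) :
  fixes_from m x -> (sp_abs x q < m) = (q < m).
Proof.
move/fixes_fromP => F; case: (ltnP q m) => [lt|le]; last first.
  by have [E _] := F q le; rewrite E; lia.
rewrite ltnNge; apply/negP => le; have [E _] := F _ le.
by move: le; rewrite (perm_inj E) leqNgt lt.
Qed.

Definition increasing_below n (k : nat) (x : signed_perm n) : Prop :=
  (forall q : 'I_n, sp_abs x q < k -> sp_neg x q = false) /\
  (forall p q : 'I_n, sp_abs x p < k -> sp_abs x q < k -> p < q -> sp_abs x p < sp_abs x q).

Lemma min_coset_rep_descent n (k j : 'I_n) (x : signed_perm n) :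
  min_coset_rep k x -> j < k -> length x <= length (simple j * x)%g.
Proof.
case/andP => _ /forall_inP H jk; apply: H; rewrite mem_rcoset mulgK.
by apply: mem_gen; apply/imset_f; rewrite inE.
Qed.

Lemma refl_mul n (x : signed_perm n) (q r : 'I_n) e :
  (refl q r e * x = x * refl (pos x q) (pos x r)
     (e (+) sp_neg x (pos x q) (+) sp_neg x (pos x r)))%g.
Proof. by rewrite -refl_conj !posK conjgC. Qed.

(** A minimal representative has no left descent among the simple reflections
    below [k].  Left multiplication by the simple reflection [j] is right
    multiplication by a reflection at the positions of the letters [j - 1] and
    [j], so by induction on [j] the letters are positive and in increasing order. *)
Lemma min_coset_rep_increasing n (k : 'I_n) (x : signed_perm n) :
  min_coset_rep k x -> increasing_below k x.
Proof.
move=> mx; suff key m : forall j : 'I_n, j = m :> nat -> j < k ->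
    ~~ sp_neg x (pos x j) /\ (forall i : 'I_n, i < j -> pos x i < pos x j).
  split=> [q /(key _ _ erefl)[]|p q pk qk pq]; first by rewrite absK => /negbTE.
  have [//|lt|/val_inj/perm_inj E] := ltngtP (sp_abs x p) (sp_abs x q).
    by have [_ /(_ _ lt)] := key _ _ erefl pk; rewrite !absK; lia.
  by rewrite E ltnn in pq.
have no_down (j : 'I_n) u : j < k -> (simple j * x = u)%g -> ~ bruhat_step u x.
  move=> jk E /andP[lt _]; have := min_coset_rep_descent mx jk.
  by rewrite E leqNgt lt.
elim: m => [|m IH] j jm jk.
  split=> [|i]; last by rewrite jm.
  apply/negP => sj; apply: (no_down j _ jk _); last first.
    apply: (@bruhat_step_negswap _ x (pos x j) (pos x j)).
    by rewrite entryE sj; lia.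
  by rewrite simple0E // refl_mul sj.
have j0 : 0 < j by rewrite jm.
pose j' := ord_pred j; have j'E : j' = m :> nat by rewrite ord_predE // jm.
have j'k : j' < k by lia.
have [sj' posj'] := IH j' j'E j'k.
have sE : simple j = refl j' j false by rewrite simpleSE.
have jneq : pos x j != pos x j' :> nat by rewrite pos_neq posK; lia.
have sj : sp_neg x (pos x j) = false.
  apply/negP => sj; apply: (no_down j _ jk _); last first.
    apply: (@bruhat_step_negswap _ x (pos x j') (pos x j)).
    by rewrite !entryE !posK sj (negbTE sj'); lia.
  by rewrite sE refl_mul sj (negbTE sj').
split=> [|i]; first by rewrite sj.
have lt : pos x j' < pos x j.
  have [//|lt|E] := ltngtP (pos x j') (pos x j); last by rewrite E eqxx in jneq.
  case: (no_down j (x * refl (pos x j') (pos x j) false)%g jk).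
    by rewrite sE refl_mul sj (negbTE sj').
  rewrite reflC; apply: bruhat_step_swap => //.
  by rewrite !entryE !posK sj (negbTE sj'); lia.
rewrite jm ltnS leq_eqVlt => /predU1P[im|im].
  by rewrite (_ : i = j') //; exact/val_inj/(etrans im (esym j'E)).
by apply: ltn_trans lt; apply: posj'; rewrite j'E.
Qed.

(** Distance of letter [k] from its place in the identity along the chain of
    signed positions k, ..., 1, -1, -2, ...  A simple reflection moves a letter by
    at most one step, which bounds the length from below. *)
Definition travel n (k : 'I_n) (w : signed_perm n) : nat :=
  if sp_neg w (pos w k) then k.+1 + pos w k else k - pos w k.

Lemma travel_simple n (k j : 'I_n) (w : signed_perm n) :
  travel k (w * simple j)%g <= (travel k w).+1.
Proof.
rewrite /travel; case: (posnP j) => [j0|j0].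
  rewrite simple0E // pos_refl neg_refl tperm1 !perm1 orbb.
  have -> : (pos w k == j) = (pos w k == 0 :> nat) by rewrite -j0.
  by case: eqP => E; case: (sp_neg w _) => /=; lia.
rewrite simpleSE // pos_refl neg_refl tpermK /=; case: tpermP => [->|->|_ _]; rewrite ?ord_predE //;
  case: (sp_neg w _) => /=; lia.
Qed.

Lemma travel_length n (k : 'I_n) (w : signed_perm n) : travel k w <= length w.
Proof.
have /has_wordP[s <- ->] := has_word_length w.
elim/last_ind: s => [|s j IH].
  rewrite big_nil /travel /= ffunE.
  have -> : pos 1%g k = k by rewrite -[in LHS](perm1 k) (absK 1%g).
  by rewrite subnn.
by rewrite -cats1 big_cat big_seq1 size_cat addn1; apply: leq_trans (travel_simple _ _ _) _.
Qed.

(** The shape of a minimal representative: letter [k], with any sign, inserted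
    into the identity of the smaller letters. *)
Definition inserted n (k : 'I_n) (x : signed_perm n) : Prop :=
  fixes_from k.+1 x /\ increasing_below k x.

Lemma min_coset_rep_inserted n (k : 'I_n) (x : signed_perm n) :
  min_coset_rep k x -> inserted k x.
Proof.
move=> mx; split; last exact: min_coset_rep_increasing.
by case/andP: mx => /parabolic_fixes.
Qed.

Lemma pos_inserted n (k : 'I_n) (x : signed_perm n) : fixes_from k.+1 x -> pos x k <= k.
Proof. by move=> F; rewrite -ltnS -(parabolic_abs_lt _ F) posK. Qed.

Lemma travel_code n (k : 'I_n) (x : signed_perm n) :
  fixes_from k.+1 x -> travel k x = code x k.
Proof.
move=> F; rewrite /travel /code; suff -> : smaller_left x k = pos x k by [].
apply/eqP; rewrite eqn_leq smaller_left_pos; apply: smaller_left_ge => // q lt.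
have : sp_abs x q < k.+1 by rewrite parabolic_abs_lt // ltnS (leq_trans (ltnW lt)) ?pos_inserted.
by have := pos_neq x k q; lia.
Qed.

(** Applied to a permutation and to its inverse, this shows that an increasing
    permutation is the identity. *)
Lemma increasing_ge n m (f : 'I_n -> 'I_n) :
  (forall p q : 'I_n, p < q -> q < m -> f p < f q) -> forall q : 'I_n, q < m -> q <= f q.
Proof.
move=> inc [q ltq] /=; elim: q ltq => // q IH ltq ltm.
apply: leq_ltn_trans (IH (ltnW ltq) (ltnW ltm)) _.
by apply: (inc (Ordinal (ltnW ltq)) (Ordinal ltq)) => /=.
Qed.

Lemma inserted_travel0 n (k : 'I_n) (x : signed_perm n) :
  inserted k x -> travel k x = 0 -> x = 1%g.
Proof.
move=> [F [npos inc]]; have Pk := pos_inserted F.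
rewrite /travel; case: ifP => // nk /eqP; rewrite subn_eq0 => kP.
have Pk' : pos x k = k by apply/val_inj/eqP; rewrite eqn_leq Pk.
have lt q : (sp_abs x q < k) = (q < k).
  have := parabolic_abs_lt q F; have := pos_neq x k q; rewrite Pk'; lia.
have inc_pos (p q : 'I_n) : p < q -> q < k -> pos x p < pos x q.
  move=> pq qk; have [//|lt'|E] := ltngtP (pos x p) (pos x q).
    by have := inc _ _ _ _ lt'; rewrite !posK; lia.
  by move/val_inj/(congr1 (sp_abs x)): E pq; rewrite !posK => ->; rewrite ltnn.
have ge1 := increasing_ge (fun p q pq qk =>
  inc p q (etrans (lt p) (ltn_trans pq qk)) (etrans (lt q) qk) pq).
have ge2 := increasing_ge inc_pos.
apply: signed_permP => [|q].
  apply/permP => q; rewrite perm1; apply/val_inj => /=.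
  have [qk|] := ltnP q k.
    have := ge1 q qk; have := ge2 (sp_abs x q); rewrite lt absK => /(_ qk); lia.
  rewrite leq_eqVlt => /predU1P[/val_inj <-|kq]; first by rewrite -{1}Pk' posK.
  by have [/fixes_fromP/(_ q kq)[-> _]] := F.
rewrite ffunE; have [qk|] := ltnP q k; first by rewrite npos // lt.
rewrite leq_eqVlt => /predU1P[/val_inj <-|kq]; first by rewrite -Pk'.
by have [/fixes_fromP/(_ q kq)[_ ->]] := F.
Qed.

Lemma inserted_swap n (k a b : 'I_n) (x : signed_perm n) :
    inserted k x -> b = a.+1 :> nat -> b <= k -> (pos x k == a) || (pos x k == b) ->
  inserted k (x * refl a b false)%g.
Proof.
move=> [/fixes_fromP F [npos inc]] ab bk Pab; split.
  apply/fixes_fromP => q kq; rewrite neg_refl abs_refl tperm_neq_val; try lia.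
  by have [-> ->] := F q kq.
split=> [q|p q]; first by rewrite neg_refl abs_refl /=; apply: npos.
have Pk := posK x k.
rewrite !abs_refl => pk qk pq; apply: inc => //.
case: (tpermP a b p) pk => [E|E|/eqP pa /eqP pb] pk;
  case: (tpermP a b q) qk => [E'|E'|/eqP qa /eqP qb] qk; subst=> //; try lia.
- by case/predU1P: Pab Pk => [->|/eqP ->] E; rewrite E ltnn in pk qk.
- have := qb; rewrite -val_eqE /=; lia.
- have := pa; rewrite -val_eqE /=; lia.
Qed.

Lemma inserted_flip n (k a : 'I_n) (x : signed_perm n) :
  inserted k x -> pos x k = a -> a = 0 :> nat -> inserted k (x * refl a a true)%g.
Proof.
move=> [/fixes_fromP F [npos inc]] Pa a0.
have absE q : sp_abs (x * refl a a true)%g q = sp_abs x q by rewrite abs_refl tperm1 perm1.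
split; [apply/fixes_fromP => q kq|split=> [q|p q]]; rewrite !absE ?neg_refl ?tperm1 ?perm1 ?orbb.
- have [-> ->] := F q kq; split=> //=; rewrite addbF; apply/eqP => E.
  by move: kq; rewrite E a0.
- move=> qk; rewrite npos // addbF /=; apply/eqP => E.
  by move: qk; rewrite E -Pa posK ltnn.
exact: inc.
Qed.

(** The letter with index [c] of the word s_k ... s_1 s_0 s_1 ... s_k, whose
    prefixes move letter [k] through all its signed positions. *)
Definition path_letter n (k : 'I_n) (c : nat) : 'I_n := insubd k ((k - c) + (c - k)).

Fixpoint insertion n (k : 'I_n) (c : nat) : signed_perm n :=
  if c is c'.+1 then (insertion k c' * simple (path_letter k c'))%g else 1%g.

Lemma path_letterE n (k : 'I_n) c : c <= 2 * k -> path_letter k c = (k - c) + (c - k) :> nat.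
Proof. by move=> le; rewrite /path_letter val_insubd ifT //; have := ltn_ord k; lia. Qed.

Lemma has_word_insertion n (k : 'I_n) c : has_word (insertion k c) c.
Proof.
elim: c => [|c /has_wordP[s <- E]]; apply/has_wordP; first by exists [::]; rewrite ?big_nil.
exists (rcons s (path_letter k (size s))); first by rewrite size_rcons.
by rewrite -cats1 big_cat big_seq1 /= E.
Qed.

Lemma inserted_insertion n (k : 'I_n) (x : signed_perm n) c :
  inserted k x -> travel k x = c -> x = insertion k c.
Proof.
elim: c x => [|c IH] x Ix; first exact: inserted_travel0.
have Pk := pos_inserted Ix.1; move=> T /=.
have cle : c <= 2 * k by move: T; rewrite /travel; case: ifP => _; lia.
have jE := path_letterE cle; set j := path_letter k c in jE *.
suff [Iy Ty] : inserted k (x * simple j)%g /\ travel k (x * simple j)%g = c.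
  rewrite -(IH _ Iy Ty); case: (posnP j) => [j0|j0].
    by rewrite simple0E // reflK.
  by rewrite simpleSE // reflK.
move: T; rewrite /travel; case: ifP => sg T; last first.
  have jP : j = (pos x k).+1 :> nat by lia.
  have pE : ord_pred j = pos x k by apply: val_inj; rewrite [LHS]ord_predE ?jP.
  rewrite simpleSE ?jP // pE.
  split; first by apply: inserted_swap => //; rewrite ?eqxx // jP; lia.
  by rewrite neg_refl pos_refl tpermL tpermR /= sg; lia.
have jP : j = pos x k by apply: val_inj => /=; lia.
case: (posnP j) => [j0|j0].
  rewrite simple0E //; split; first exact: inserted_flip.
  by rewrite neg_refl pos_refl tperm1 !perm1 jP eqxx /= sg -jP j0; move: T; rewrite -jP j0 /=; lia.
rewrite simpleSE //; have := ord_predE j0; move: (ord_pred j) => i iE; split.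
  by apply: inserted_swap => //; rewrite ?jP ?eqxx ?orbT // -jP iE prednK.
rewrite neg_refl pos_refl -jP tpermR tpermL /= [in sp_neg _ _]jP sg iE.
by move: T; rewrite -jP; lia.
Qed.

Lemma inserted_length n (k : 'I_n) (x : signed_perm n) :
  inserted k x -> length x = code x k.
Proof.
move=> Ix; have TE := travel_code Ix.1; apply/eqP; rewrite eqn_leq -{2}TE travel_length andbT.
by have := has_word_insertion k (code x k); rewrite -(inserted_insertion Ix TE) => /length_min.
Qed.

(** * The Lehmer code is the insertion code *)

(** Inserting the letter [j] on the right keeps the smaller letters in order, with
    their signs. *)
Lemma code_mulr_inserted n (k j : 'I_n) (v x : signed_perm n) :
  k < j -> fixes_from j v -> inserted j x -> code (v * x)%g k = code v k.
Proof.
move=> kj Fv [Fx [npos inc]].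
have posM y : pos (v * x)%g y = pos x (pos v y) by rewrite /pos /= invMg permM.
have Pj : pos v k < j by rewrite -(parabolic_abs_lt _ Fv) posK.
have incP (q : 'I_n) : sp_abs v (sp_abs x q) < k ->
    (q < pos (v * x)%g k) = (sp_abs x q < pos v k).
  move=> lt; have qj : sp_abs x q < j by rewrite -(parabolic_abs_lt _ Fv); lia.
  rewrite posM; have PP : sp_abs x (pos x (pos v k)) = pos v k by rewrite posK.
  have [lt'|lt'|/val_inj E] := ltngtP q (pos x (pos v k)).
  - by rewrite -{1}PP inc // PP.
  - by have := inc _ _ _ _ lt'; rewrite PP; lia.
  by rewrite E PP ltnn.
have LE : smaller_left (v * x)%g k = smaller_left v k.
  rewrite /smaller_left -(card_imset _ (@perm_inj _ (sp_abs x))).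
  apply: eq_card => y; rewrite [RHS]inE; apply/imsetP/andP => [[q]|[y1 y2]].
    by rewrite inE /= permM => /andP[q1 q2] ->; rewrite -incP.
  have lt : sp_abs v (sp_abs x (pos x y)) < k by rewrite posK.
  by exists (pos x y); rewrite ?posK // inE /= permM (incP _ lt) lt posK y1.
by rewrite /code LE posM /= ffunE posK npos ?posK.
Qed.

(** A factor on the left that involves only letters below [k] permutes them among
    themselves and leaves the place of [k] as it is. *)
Lemma code_mull_fixes n (k : 'I_n) (v x : signed_perm n) :
  fixes_from k v -> code (v * x)%g k = code x k.
Proof.
move=> Fv; have /fixes_fromP/(_ k (leqnn k))[vk nk] := Fv.
have posM : pos (v * x)%g k = pos x k.
  rewrite /pos /= invMg permM; congr (_ _); rewrite -{1}vk; exact: absK.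
have LE : smaller_left (v * x)%g k = smaller_left x k.
  rewrite /smaller_left; apply: eq_card => q.
  by rewrite !inE posM /= permM parabolic_abs_lt.
by rewrite /code LE posM /= ffunE posK nk addbF.
Qed.

Lemma factorsP n (w : signed_perm n) :
  (forall k : 'I_n, min_coset_rep k (factors w k)) /\ w = (\prod_(k < n) factors w k)%g.
Proof. by have /andP[/forallP H /eqP E] := xchooseP (exists_factorization w). Qed.

Lemma code_prod n (f : 'I_n -> signed_perm n) (k : 'I_n) :
  (forall j, inserted j (f j)) -> code (\prod_(j < n) f j)%g k = code (f k) k.
Proof.
move=> If; pose g i := if insub i is Some j then f j else 1%g.
have gE (j : 'I_n) : g j = f j by rewrite /g valK.
have -> : (\prod_(j < n) f j = \prod_(0 <= i < n) g i)%g.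
  by rewrite big_mkord; apply: eq_bigr => j _; rewrite gE.
have fixes m : m <= n -> fixes_from m (\prod_(0 <= i < m) g i)%g.
  elim: m => [|m IH] lt.
    by rewrite big_nil; have := group1 (Group (fixes_from_group n 0)); rewrite inE.
  rewrite big_nat_recr //=; have := groupM (G := Group (fixes_from_group n m.+1)).
  move=> /(_ (\prod_(0 <= i < m) g i)%g (g m)); rewrite !inE; apply.
    apply/fixes_fromP => q ltq; have /fixes_fromP := IH (ltnW lt); apply.
    exact: ltnW.
  by have [] := If (Ordinal lt); rewrite -gE.
suff H m : k < m -> m <= n -> code (\prod_(0 <= i < m) g i)%g k = code (f k) k by apply: H.
elim: m => // m IH; rewrite ltnS leq_eqVlt => /predU1P[<-|km] lt.
  rewrite big_nat_recr //= code_mull_fixes ?gE //.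
  by apply: fixes; apply: ltnW.
rewrite big_nat_recr //= (@code_mulr_inserted _ _ (Ordinal lt)) ?IH ?fixes // 1?ltnW //.
by rewrite -[g m]/(g (Ordinal lt)) gE.
Qed.

Lemma lehmerE n (w : signed_perm n) : lehmer w =1 code w.
Proof.
have [min_f wE] := factorsP w; move=> k; rewrite ffunE.
have If j := min_coset_rep_inserted (min_f j).
by rewrite (inserted_length (If k)) [in RHS]wE code_prod.
Qed.

Lemma code_inj n (u w : signed_perm n) : code u =1 code w -> u = w.
Proof.
have [min_u uE] := factorsP u; have [min_w wE] := factorsP w.
move: (factors u) (factors w) min_u min_w uE wE => f g min_f min_g -> -> E.
apply: eq_bigr => k _.
have If j := min_coset_rep_inserted (min_f j).
have Ig j := min_coset_rep_inserted (min_g j).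
have fgk : code (f k) k = code (g k) k by rewrite -(code_prod k If) E code_prod.
rewrite (inserted_insertion (If k) (travel_code (If k).1)) fgk.
by rewrite -(inserted_insertion (Ig k) (travel_code (Ig k).1)).
Qed.

(** * Counting: ballot numbers and chains *)

(** The number of sequences of length [m] of natural numbers that start with a
    value at most [b] and increase by at most one at each step. *)
Fixpoint ballot (m b : nat) : nat :=
  if m is m'.+1 then \sum_(x < b.+1) ballot m' x.+1 else 1.

Lemma ballotS0 m : ballot m.+1 0 = ballot m 1.
Proof. by rewrite /= big_ord_recr big_ord0. Qed.

Lemma ballotSS m b : ballot m.+1 b.+1 = ballot m.+1 b + ballot m b.+2.
Proof. by rewrite /= big_ord_recr. Qed.

(** The reflection principle for ballot paths, proved from [ballotSS] and Pascal's
    rule. *)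
Lemma ballot_bin m b :
  ballot m.+1 b + 'C(2 * m.+1 + b, m) = 'C(2 * m.+1 + b, m.+1).
Proof.
elim: m b => [|m IHm] b.
  by rewrite bin0 bin1 /= sum1_card card_ord; lia.
elim: b => [|b IHb].
  rewrite ballotS0 !addn0; have := IHm 1.
  have -> : 2 * m.+1 + 1 = (2 * m).+3 by lia.
  have -> : 2 * m.+2 = (2 * m).+4 by lia.
  have E : 'C((2 * m).+3, m.+2) = 'C((2 * m).+3, m.+1).
    by rewrite -bin_sub; [congr binomial; lia | lia].
  by rewrite !(binS _.+3) E; lia.
rewrite ballotSS; have := IHm b.+2; move: IHb.
have -> : 2 * m.+1 + b.+2 = 2 * m.+2 + b by lia.
by rewrite addnS !binS; lia.
Qed.

Lemma catalanE m : catalan m = (ballot m 0)%:R%R.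
Proof.
rewrite /catalan; case: m => [|m]; first by rewrite bin0 invr1 mul1r.
have := ballot_bin m 0; rewrite addn0.
have := mul_bin_left (2 * m.+1) m; have -> : 2 * m.+1 - m = m.+2 by lia.
move=> B1 B2; have E : m.+2 * ballot m.+1 0 = 'C(2 * m.+1, m.+1) by nia.
by rewrite -E natrM mulKf // pnatr_eq0.
Qed.

Definition next_letters (ok : nat -> nat -> pred nat) (i p : nat) : seq nat :=
  [seq x <- iota 0 (2 * i).+2 | ok i p x].

Lemma mem_next_letters ok i p x : (x \in next_letters ok i p) = (x < (2 * i).+2) && ok i p x.
Proof. by rewrite mem_filter mem_iota andbC. Qed.

(** The sequences of length [m] whose values, at the indices [i], [i + 1], ..., lie
    in the box and are allowed by [ok] after the preceding value, initially [p]. *)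
Fixpoint chains (ok : nat -> nat -> pred nat) (i p m : nat) : seq (seq nat) :=
  if m is m'.+1 then
    [seq x :: s | x <- next_letters ok i p, s <- chains ok i.+1 x m']
  else [:: [::]].

Fixpoint is_chain (ok : nat -> nat -> pred nat) (i p : nat) (s : seq nat) : bool :=
  if s is x :: s' then [&& x < (2 * i).+2, ok i p x & is_chain ok i.+1 x s'] else true.

Lemma mem_chains ok i p m s : (s \in chains ok i p m) = (size s == m) && is_chain ok i p s.
Proof.
elim: m i p s => [|m IH] i p [|x s] //=; first by apply/allpairsPdep => -[? [? []]].
apply/allpairsPdep/and4P => [[y [t [yi tc [-> ->]]]]|[sz lt okx sc]].
  move: yi tc; rewrite mem_next_letters IH => /andP[-> ->] /andP[/eqP -> ->].
  by rewrite eqxx.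
by exists x, s; rewrite mem_next_letters IH okx sc lt -eqSS sz.
Qed.

Lemma chains_uniq ok i p m : uniq (chains ok i p m).
Proof.
elim: m i p => //= m IH i p; apply: allpairs_uniq_dep => //.
  exact/filter_uniq/iota_uniq.
by move=> [x s] [y t] _ _ /= [-> ->].
Qed.

Lemma size_chainsS ok i p m :
  size (chains ok i p m.+1) =
  \sum_(x < (2 * i).+2 | ok i p x) size (chains ok i.+1 x m).
Proof.
rewrite /= size_allpairs_dep sumnE big_map big_filter.
by rewrite -[iota _ _]/(index_iota 0 (2 * i).+2) big_mkord.
Qed.

Lemma size_chains_box i p m :
  size (chains (fun _ _ _ => true) i p m) * (i`! * 2 ^ i) = (i + m)`! * 2 ^ (i + m).
Proof.
elim: m i p => [|m IH] i p; first by rewrite addn0 mul1n.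
rewrite size_chainsS addnS -addSn -(IH i.+1 0).
rewrite (eq_bigr (fun=> size (chains (fun _ _ _ => true) i.+1 0 m))); last first.
  move=> x _; apply/eqP; rewrite -(@eqn_pmul2r (i.+1`! * 2 ^ i.+1)) ?IH //.
  by rewrite muln_gt0 fact_gt0 expn_gt0.
rewrite sum_nat_const card_ord factS expnS; lia.
Qed.

(** At [i = 0] the truncated predecessor makes the condition void, so that any
    value may serve as [p]. *)
Definition growth_ok (i p : nat) : pred nat := fun x =>
  (p < (2 * i).-1) ==> ((x <= p.+1) && (x + p <= (2 * i).-1)).

(** A value [x] chosen at [i] is at most [i], so from the next index on the bound
    [x + 1] is the smaller of the two and only ballot growth remains. *)
Lemma size_chains_nonmax i p m : p < (2 * i).-1 ->
  size (chains growth_ok i p m) = ballot m (minn p.+1 ((2 * i).-1 - p)).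
Proof.
elim: m i p => // m IH i p nmax; rewrite size_chainsS /=; set b := minn _ _.
have ltb : b.+1 <= (2 * i).+2 by rewrite /b; lia.
rewrite (big_ord_widen _ (fun x => ballot m x.+1) ltb).
apply: eq_big => [x|x]; first by rewrite /growth_ok nmax /b; lia.
rewrite /growth_ok nmax /= => /andP[x1 x2]; rewrite IH; last by lia.
by congr ballot; lia.
Qed.

(** The bound climbs to [i.+1] and descends again to 1. *)
Lemma sum_ballot_min m i :
  \sum_(x < (2 * i).+1) ballot m (minn x.+1 ((2 * i).+1 - x)) =
  ballot m.+1 i + \sum_(x < i) ballot m x.+1.
Proof.
have -> : (2 * i).+1 = i.+1 + i by lia.
rewrite big_split_ord /=; congr (_ + _).
  by apply: eq_bigr => x _; congr ballot; have := ltn_ord x; lia.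
rewrite (reindex_inj rev_ord_inj); apply: eq_bigr => x _ /=.
by congr ballot; have := ltn_ord x; lia.
Qed.

(** The value at [i] is either nonmaximal, counted by [sum_ballot_min], or maximal,
    which leads to the same count at [i.+1]; [ballotSS] telescopes the total. *)
Lemma size_chains_max i p m : (2 * i).-1 <= p ->
  (size (chains growth_ok i p m)).+1 = ballot m i.+1 + ballot m i.
Proof.
elim: m i p => // m IH i p max; rewrite size_chainsS.
rewrite (eq_bigl xpredT); last by move=> x; rewrite /growth_ok ltnNge max.
rewrite big_ord_recr -addnS IH /=; last by lia.
under eq_bigr => x _.
  rewrite size_chains_nonmax; last by have := ltn_ord x; lia.
  have -> : (2 * i.+1).-1 = (2 * i).+1 by lia.
  over.
rewrite sum_ballot_min /= [in RHS]big_ord_recr /= [X in _ = _ + X]big_ord_recr /=.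
by lia.
Qed.

(** * The growth condition, principality and the final count *)

Lemma is_chainP (ok : nat -> nat -> pred nat) i p s :
  reflect (forall j, j < size s -> nth 0 s j < (2 * (i + j)).+2 /\
                                   ok (i + j) (nth 0 (p :: s) j) (nth 0 s j))
          (is_chain ok i p s).
Proof.
elim: s i p => [|x s IH] i p /=; first by apply: ReflectT.
apply: (iffP and3P) => [[lt okx /IH H] [|j] // ltj|H].
- by rewrite addn0.
- by rewrite addnS -addSn; apply: H.
have [] := H 0 isT; rewrite addn0 => lt okx; split=> //.
by apply/IH => j ltj; have := H j.+1 ltj; rewrite /= addnS -addSn.
Qed.

Definition code_seq n (w : signed_perm n) : seq nat := [seq code w i | i <- enum 'I_n].

Lemma size_code_seq n (w : signed_perm n) : size (code_seq w) = n.
Proof. by rewrite size_map size_enum_ord. Qed.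

Lemma nth_code_seq n (w : signed_perm n) (i : 'I_n) : nth 0 (code_seq w) i = code w i.
Proof. by rewrite (nth_map i) ?size_enum_ord // nth_ord_enum. Qed.

Lemma code_seq_inj n : injective (@code_seq n).
Proof. by move=> u w E; apply: code_inj => i; rewrite -!nth_code_seq E. Qed.

Lemma growth_chainP n (w : signed_perm n) :
  growth (code w) <-> is_chain growth_ok 0 0 (code_seq w).
Proof.
split=> [G|/is_chainP H h i ih nmax].
  apply/is_chainP => j; rewrite size_code_seq => ltj; rewrite add0n.
  have wj := nth_code_seq w (Ordinal ltj); rewrite /= in wj.
  rewrite wj ltnS code_le; split=> //; case: j ltj wj => // j ltj wj.
  have wj' := nth_code_seq w (Ordinal (ltnW ltj)); rewrite /= in wj' *.
  apply/implyP => nmax; rewrite wj'.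
  have := G (Ordinal (ltnW ltj)) (Ordinal ltj) erefl; rewrite -wj' /=.
  by case; lia.
have := H i; rewrite size_code_seq ltn_ord nth_code_seq add0n ih => /(_ isT)[_].
by rewrite /= nth_code_seq /growth_ok; lia.
Qed.

Lemma card_signed_perm n : #|{: signed_perm n}| = n`! * 2 ^ n.
Proof.
have bij : bijective (@sp_pair n) by exists (@pair_sp n); [exact: sp_pairK | case].
by rewrite (bij_eq_card bij) card_prod card_Sn card_ffun card_bool card_ord.
Qed.

(** The codes lie in the box, are pairwise distinct, and are as many as the box
    has elements. *)
Lemma code_seq_box n :
  [seq code_seq w | w : signed_perm n] =i chains (fun _ _ _ => true) 0 0 n.
Proof.
have sub : {subset [seq code_seq w | w : signed_perm n] <= chains (fun _ _ _ => true) 0 0 n}.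
  move=> _ /mapP[w _ ->]; rewrite mem_chains size_code_seq eqxx.
  apply/is_chainP => j; rewrite size_code_seq => ltj; split=> //.
  by rewrite add0n (nth_code_seq w (Ordinal ltj)) ltnS code_le.
have un : uniq [seq code_seq w | w : signed_perm n].
  by rewrite map_inj_uniq ?enum_uniq //; apply: code_seq_inj.
suff le : size (chains (fun _ _ _ => true) 0 0 n) <=
          size [seq code_seq w | w : signed_perm n].
  by have [] := uniq_min_size un sub le.
rewrite size_map -cardE card_signed_perm.
by have := size_chains_box 0 0 n; rewrite muln1 => ->.
Qed.

Lemma card_growth n :
  #|[set w : signed_perm n | is_chain growth_ok 0 0 (code_seq w)]|.+1 =
  ballot n 1 + ballot n 0.
Proof.
rewrite -(@size_chains_max 0 0 n isT); congr S.
rewrite cardE -(size_map (@code_seq n)); apply/perm_size/uniq_perm.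
- by rewrite map_inj_uniq ?enum_uniq //; apply: code_seq_inj.
- exact: chains_uniq.
move=> s; apply/mapP/idP => [[w]|].
  by rewrite mem_enum inE mem_chains => G ->; rewrite size_code_seq eqxx.
rewrite mem_chains => /andP[sz G].
have : s \in chains (fun _ _ _ => true) 0 0 n.
  rewrite mem_chains sz; apply/is_chainP => j ltj; split=> //.
  by have /is_chainP/(_ j ltj)[] := G.
by rewrite -code_seq_box => /mapP[w _ E]; exists w; rewrite // mem_enum inE -E.
Qed.

Lemma rbg_growth n (w : signed_perm n) :
  rbg [ffun i => (lehmer w i)%:Z%R] <-> growth (code w).
Proof.
have rbgE i : [ffun i => (lehmer w i)%:Z%R] i = (code w i)%:Z%R by rewrite ffunE lehmerE.
split=> [[_ R] h i ih nmax|G].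
  have := R h i ih; rewrite !rbgE => H.
  have {}H : ((code w i)%:Z <= Order.min ((code w h)%:Z + 1) (2 * i.+1%:Z - 3 - (code w h)%:Z))%R.
    by apply: H; lia.
  by move: H; rewrite le_min; lia.
split=> [i|h i ih]; rewrite !rbgE; first by have := code_le w i; lia.
move=> nmax; have [|g1 g2] := G h i ih; first by lia.
by rewrite le_min; lia.
Qed.

Lemma lehmer_leE n (u w : signed_perm n) k :
  (lehmer u k <= lehmer w k) = (code u k <= code w k).
Proof. by congr (_ <= _); apply: lehmerE. Qed.

Lemma principal_growth n (w : signed_perm n) : principal w <-> growth (code w).
Proof.
split=> [/forall_inP P h i ih nmax|G].
  apply: growth_code_defect => // /(defect_rise ih)[u uw].
  by have /forallP/(_ h) := P u uw; rewrite lehmer_leE leqNgt => /negP.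
apply/forall_inP => u uw; apply/forallP => i; rewrite lehmer_leE.
exact: growth_code_le.
Qed.

Lemma growth_avoidsP n (w : signed_perm n) :
  growth (code w) <-> forall v, v \in lehmer_patterns -> avoids (window w) v.
Proof.
split=> [G v|A h i ih nmax]; first exact: growth_avoids.
by apply: growth_code_defect => // /(defect_contains ih)[v /A].
Qed.

Local Open Scope ring_scope.

Theorem theorem5p1 (n : nat) (hn : (1 <= n)%N) :
  (forall w : signed_perm n,
     (principal w <-> rbg [ffun i => (lehmer w i)%:Z]) /\
     (rbg [ffun i => (lehmer w i)%:Z] <->
      forall v, v \in lehmer_patterns -> avoids (window w) v)) /\
  #|[set w : signed_perm n | principal w]|%:R = catalan n + catalan n.+1 - 1.
Proof.
split=> [w|].
  by rewrite rbg_growth principal_growth -growth_avoidsP.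
have -> : [set w : signed_perm n | principal w] =
          [set w | is_chain growth_ok 0 0 (code_seq w)].
  apply/setP => w; rewrite !inE.
  by apply/idP/idP => [/principal_growth/growth_chainP|/growth_chainP/principal_growth].
by rewrite !catalanE ballotS0 -natrD addnC -card_growth -addn1 natrD addrK.
Qed.
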